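(* Let $N\ge 1$, $s\in(0,1)$, $\alpha_1,\alpha_2\in\mathbb{R}$, let $\gamma:=s-\alpha_1-\alpha_2$, and let $R>0$. Let $\Phi$ be an Orlicz function. (i) If $p_\Phi^\oplus$ is attained and $\gamma=N/p_\Phi^\oplus$, then there is a constant $C>0$, independent of $u$, such that for every $u\in\mathcal{C}_c^1(\mathbb{R}^N)$ with $\mathrm{supp}(u)\subset B_R(0)$, $$\int_{B_R(0)}\frac{\Phi(|x|^{-\gamma}|u(x)|)}{\big(\log(2R/|x|)\big)^{p_\Phi^\oplus}}\,dx\le C\int_{\mathbb{R}^N}\int_{\mathbb{R}^N}\Phi\left(|x|^{\alpha_1}|y|^{\alpha_2}|D_su(x,y)|\right)d\mu.$$ (ii) If $p_\Phi^\ominus$ is attained at $\Psi\asymp\Phi$ and $\gamma=N/p_\Phi^\ominus$, then there is a constant $C>0$, independent of $u$, such that for every $u\in\mathcal{C}_c^1(\mathbb{R}^N)$ with $\mathrm{supp}(u)\subset B_R(0)^c$, $$\int_{B_R(0)^c}\frac{\Phi(|x|^{-\gamma}|u(x)|)}{\big(\log(2|x|/R)\big)^{p_\Psi^+}}\,dx\le C\int_{\mathbb{R}^N}\int_{\mathbb{R}^N}\Phi\left(|x|^{\alpha_1}|y|^{\alpha_2}|D_su(x,y)|\right)d\mu.$$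
   Context: An Orlicz function is a continuous convex function $\Phi:[0,\infty)\to[0,\infty)$ such that $\lim_{t\to0}\Phi(t)/t=0$, $\lim_{t\to\infty}\Phi(t)/t=\infty$, and there is a constant $C>0$ with $\Phi(2t)\le C\Phi(t)$ for all $t\ge0$ (the $\Delta_2$-condition). Such a $\Phi$ can be written $\Phi(t)=\int_0^t\varphi(s)\,ds$, where $\varphi$ (the right derivative of $\Phi$) is non-decreasing and right continuous on $[0,\infty)$, $\varphi(0)=0$, $\varphi(t)>0$ for $t>0$, and $\lim_{t\to\infty}\varphi(t)=\infty$. Define $p_\Phi^-:=\inf_{t>0}\frac{t\varphi(t)}{\Phi(t)}$ and $p_\Phi^+:=\sup_{t>0}\frac{t\varphi(t)}{\Phi(t)}$; one has $1\le p_\Phi^-\le p_\Phi^+<\infty$. Two Orlicz functions $\Phi,\Psi$ are equivalent, written $\Phi\asymp\Psi$, if there are $C_1,C_2>0$ with $C_1\Phi(t)\le\Psi(t)\le C_2\Phi(t)$ for all $t\ge0$. Define $p_\Phi^\ominus:=\sup\{p_\Psi^-:\Psi\text{ Orlicz function},\ \Psi\asymp\Phi\}$ and $p_\Phi^\oplus:=\inf\{p_\Psi^+:\Psi\text{ Orlicz function},\ \Psi\asymp\Phi\}$. We say $p_\Phi^\ominus$ (resp. $p_\Phi^\oplus$) is attained at an Orlicz function $\Psi\asymp\Phi$ if $p_\Phi^\ominus=p_\Psi^-$ (resp. $p_\Phi^\oplus=p_\Psi^+$), and that it is attained if it is attained at some such $\Psi$. $B_R(0)$ is the open ball in $\mathbb{R}^N$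 centred at the origin with radius $R$, and $B_R(0)^c$ is its complement. $\mathcal{C}_c^1(\mathbb{R}^N)$ is the set of continuously differentiable functions with compact support. For a continuous $u$, $D_su(x,y):=\frac{u(x)-u(y)}{|x-y|^s}$, and $d\mu:=\frac{dx\,dy}{|x-y|^N}$ on $\mathbb{R}^N\times\mathbb{R}^N$. *)

(* Defs.v *)
From HB Require Import structures.
From mathcomp Require Import all_boot all_order all_algebra.
From mathcomp Require Import all_classical all_reals all_analysis.

Set Implicit Arguments.
Unset Strict Implicit.
Unset Printing Implicit Defensive.

Import Order.TTheory GRing.Theory Num.Theory.
Import numFieldNormedType.Exports.

Local Open Scope classical_set_scope.
Local Open Scope ring_scope.

(* R^n is 'rV[R]_n.  Its sigma-algebra is generated by the coordinate maps,
   i.e. it is the product of the Borel sigma-algebras of the factors. *)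
Section measurable_rV.
Context d (T : sigmaRingType d) (n : nat).

Let coors (i : 'I_n) (v : 'rV[T]_n) : T := v ord0 i.

Let rV_set0 : g_sigma_preimage coors set0.
Proof. exact: sigma_algebra0. Qed.

Let rV_setC A : g_sigma_preimage coors A -> g_sigma_preimage coors (~` A).
Proof. exact: sigma_algebraC. Qed.

Let rV_bigcup (F : (set 'rV[T]_n)^nat) :
  (forall i, g_sigma_preimage coors (F i)) ->
  g_sigma_preimage coors (\bigcup_i (F i)).
Proof. exact: sigma_algebra_bigcup. Qed.

HB.instance Definition _ := @isMeasurable.Build (measure_tuple_display d)
  'rV[T]_n (g_sigma_preimage coors) rV_set0 rV_setC rV_bigcup.

End measurable_rV.

Lemma measurable_coord d (T : sigmaRingType d) n (i : 'I_n) :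
  measurable_fun [set: 'rV[T]_n] (fun v : 'rV[T]_n => v ord0 i).
Proof.
move=> _ Y mY; rewrite setTI; apply: sub_sigma_algebra => /=.
rewrite -bigcup_seq/=; exists i => /=; first by rewrite mem_index_enum.
by exists Y => //; rewrite setTI.
Qed.

Lemma measurable_fun_rVP d1 d2 (T1 : measurableType d1)
    (T2 : measurableType d2) n (f : T1 -> 'rV[T2]_n) :
  (forall i, measurable_fun [set: T1] (fun x => f x ord0 i)) ->
  measurable_fun [set: T1] f.
Proof.
move=> mf.
have prefS : g_sigma_preimage (fun (i : 'I_n) (x : T1) => f x ord0 i)
    `<=` measurable.
  apply: smallest_sub; first exact: sigma_algebra_measurable.
  rewrite -bigcup_seq; apply: bigcup_sub => i _ A [B mB <-].
  exact: mf.
move=> _ A mA; rewrite setTI; apply: prefS.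
rewrite (@g_sigma_preimage_comp _ _ _ _ (fun i (v : 'rV[T2]_n) => v ord0 i)).
by exists A => //; rewrite setTI.
Qed.

Definition rV_cons (T : Type) n (p : T * 'rV[T]_n) : 'rV[T]_n.+1 :=
  \row_i oapp (fun j => p.2 ord0 j) p.1 (unlift ord0 i).

Lemma rV_cons0 (T : Type) n (p : T * 'rV[T]_n) : rV_cons p ord0 ord0 = p.1.
Proof. by rewrite mxE unlift_none. Qed.

Lemma rV_consS (T : Type) n (p : T * 'rV[T]_n) j :
  rV_cons p ord0 (lift ord0 j) = p.2 ord0 j.
Proof. by rewrite mxE liftK. Qed.

Lemma measurable_rV_cons d (T : measurableType d) n :
  measurable_fun [set: T * 'rV[T]_n] (@rV_cons T n).
Proof.
apply: measurable_fun_rVP => i.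
case: (unliftP ord0 i) => [j ->|->].
  rewrite (_ : (fun _ => _) = (fun v : 'rV[T]_n => v ord0 j) \o snd).
    by apply: measurableT_comp => //; exact: measurable_coord.
  by apply/funext => p /=; rewrite rV_consS.
rewrite (_ : (fun _ => _) = fst) //.
by apply/funext => p /=; rewrite rV_cons0.
Qed.

Lemma product_sigma_finite d1 d2 (T1 : measurableType d1)
    (T2 : measurableType d2) (R : realType)
    (m1 : {sigma_finite_measure set T1 -> \bar R})
    (m2 : {sigma_finite_measure set T2 -> \bar R}) :
  sigma_finite [set: T1 * T2] (m1 \x m2)%E.
Proof.
have /sigma_finiteP[F [TF ndF Foo]] := sigma_finiteT m1.
have /sigma_finiteP[G [TG ndG Goo]] := sigma_finiteT m2.
exists (fun k => F k `*` G k).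
  rewrite -setXTT TF TG predeqE => -[x y]; split.
    move=> [/= [k _ Fkx] [l _ Gly]]; exists (maxn k l) => //; split.
    - by move: x Fkx; exact/subsetPset/ndF/leq_maxl.
    - by move: y Gly; exact/subsetPset/ndG/leq_maxr.
  by move=> [k _ []/= ? ?]; split; exists k.
move=> k; have [? ?] := Foo k; have [? ?] := Goo k.
split; first exact: measurableX.
by rewrite product_measure1E// lte_mul_pinfty// ge0_fin_numE.
Qed.

Section lebesgue_rV_step.
Context (R : realType) (n : nat).
Variable m : {sigma_finite_measure set 'rV[R]_n -> \bar R}.
Local Open Scope ereal_scope.

Definition lebesgue_rV_step : set 'rV[R]_n.+1 -> \bar R :=
  pushforward (@lebesgue_measure R \x m) (@rV_cons R n).

Let step0 : lebesgue_rV_step set0 = 0.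
Proof. by rewrite /lebesgue_rV_step /pushforward preimage_set0 measure0. Qed.

Let step_ge0 A : 0 <= lebesgue_rV_step A.
Proof. by rewrite /lebesgue_rV_step /pushforward; exact: measure_ge0. Qed.

Let step_sigma_additive : semi_sigma_additive lebesgue_rV_step.
Proof.
have mc := @measurable_rV_cons _ R n.
move=> F mF tF mUF; rewrite /lebesgue_rV_step /pushforward preimage_bigcup.
apply: measure_semi_sigma_additive.
- by move=> i; rewrite -[X in measurable X]setTI; exact: mc.
- apply/trivIsetP => /= i j _ _ ij; rewrite -preimage_setI.
  by move/trivIsetP : tF => /(_ _ _ _ _ ij) ->//; rewrite preimage_set0.
- by rewrite -preimage_bigcup -[X in measurable X]setTI; exact: mc.
Qed.

HB.instance Definition _ := isMeasure.Build _ _ _ lebesgue_rV_step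
  step0 step_ge0 step_sigma_additive.

Let uncons (v : 'rV[R]_n.+1) : R * 'rV[R]_n :=
  (v ord0 ord0, \row_j v ord0 (lift ord0 j)).

Let measurable_uncons : measurable_fun [set: 'rV[R]_n.+1] uncons.
Proof.
apply/measurable_fun_pairP; split; first exact: measurable_coord.
apply: measurable_fun_rVP => i.
rewrite (_ : (fun _ => _) = fun v : 'rV[R]_n.+1 => v ord0 (lift ord0 i)).
  exact: measurable_coord.
by apply/funext => v /=; rewrite mxE.
Qed.

Let rV_consK : cancel (@rV_cons R n) uncons.
Proof.
move=> [x v]; rewrite /uncons rV_cons0; congr pair.
by apply/rowP => j; rewrite mxE rV_consS.
Qed.

Let step_sigma_finite : sigma_finite setT lebesgue_rV_step.
Proof.
have [F TF Foo] := product_sigma_finite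
  (lebesgue_measure : {sigma_finite_measure set (measurableTypeR R) -> \bar R})
  m.
exists (fun k => uncons @^-1` F k).
  by rewrite -preimage_bigcup -TF preimage_setT.
move=> k; have [mF Fk] := Foo k; split.
  by rewrite -[X in measurable X]setTI; exact: measurable_uncons.
rewrite /lebesgue_rV_step /pushforward -comp_preimage.
by rewrite (_ : uncons \o _ = id) //; apply/funext => p; exact: rV_consK.
Qed.

HB.instance Definition _ := Measure_isSigmaFinite.Build _ _ _ lebesgue_rV_step
  step_sigma_finite.

End lebesgue_rV_step.

(* Lebesgue measure on R^n, as the n-fold product of the Lebesgue measure
   on R; see lebesgue_rV_box. *)
Fixpoint lebesgue_rV (R : realType) (n : nat) :
    {sigma_finite_measure set 'rV[R]_n -> \bar R} :=
  if n is n'.+1 then lebesgue_rV_step (lebesgue_rV R n')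
  else (@dirac _ 'rV[R]_0 0 R : {sigma_finite_measure set 'rV[R]_0 -> \bar R}).

Lemma lebesgue_rV_box (R : realType) (n : nat) (A : 'I_n -> set R) :
  (forall i, measurable (A i)) ->
  lebesgue_rV R n [set v : 'rV[R]_n | forall i, A i (v ord0 i)] =
  (\prod_(i < n) lebesgue_measure (A i))%E.
Proof.
elim: n A => [|n IHn] A mA.
  rewrite big_ord0 /= diracE mem_set //; by case.
rewrite big_ord_recl -IHn; last by move=> i; exact: mA.
rewrite /= /lebesgue_rV_step /pushforward.
rewrite -product_measure1E; [|exact: mA|]; last first.
  rewrite (_ : [set _ | _] =
     \bigcap_(i in [set: 'I_n])
        ((fun v : 'rV[R]_n => v ord0 i) @^-1` A (lift ord0 i))).
    apply: fin_bigcap_measurable => // i _.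
    rewrite -[X in measurable X]setTI.
    exact: (@measurable_coord _ R n i measurableT _ (mA _)).
  by apply/seteqP; split => v /= H i; [move=> _; exact: H|exact: H].
congr product_measure1.
apply/seteqP; split => -[x v] /=.
  move=> H; split; first by have := H ord0; rewrite rV_cons0.
  by move=> i; have := H (lift ord0 i); rewrite rV_consS.
move=> [Ax Av] i.
by case: (unliftP ord0 i) => [j ->|->]; rewrite ?rV_cons0 ?rV_consS.
Qed.

Section euclidean.
Context (R : realType) (n : nat).
Implicit Types (x : 'rV[R]_n) (u : 'rV[R]_n -> R).

(* The norm `|x| of the library on 'rV[R]_n is the sup norm; it induces the
   same topology and differential as the Euclidean norm. *)
Definition enorm x : R := Num.sqrt (\sum_(i < n) x ord0 i ^+ 2).

Definition eball (r : R) : set 'rV[R]_n := [set x | enorm x < r].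

Definition supp u : set 'rV[R]_n := closure [set x | u x != 0].

Definition C1c u : Prop :=
  [/\ forall x, differentiable u x,
      forall i : 'I_n, continuous (fun x => 'D_(delta_mx ord0 i) u x)
    & compact (supp u)].

Definition holder_quotient (s : R) u x y : R :=
  (u x - u y) / enorm (x - y) `^ s.

End euclidean.

(* Orlicz functions are represented by maps R -> R of which only the values
   on [0, +oo[ are ever used. *)
Section orlicz.
Context (R : realType).
Implicit Types Phi Psi : R -> R.

Definition orlicz Phi : Prop :=
  [/\ forall t : R, 0 <= t -> 0 <= Phi t,
      {within `[0, +oo[, continuous Phi},
      convex_function (E := R^o) `[0, +oo[ Phi,
      Phi t / t @[t --> 0^'+] --> 0 /\ Phi t / t @[t --> +oo] --> +oo
    & exists2 C : R, 0 < C & forall t : R, 0 <= t -> Phi (2 * t) <= C * Phi t].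

Definition right_derivative Phi (t : R) : R :=
  lim (((Phi (t + h) - Phi t) / h) @[h --> 0^'+]).

Definition orlicz_index Phi (t : R) : R := t * right_derivative Phi t / Phi t.

(* The inf and sup below are taken in R: for an Orlicz function all the sets
   involved are nonempty and bounded. *)
Definition p_minus Phi : R := inf [set orlicz_index Phi t | t in `]0, +oo[].

Definition p_plus Phi : R := sup [set orlicz_index Phi t | t in `]0, +oo[].

Definition orlicz_equiv Phi Psi : Prop :=
  exists C1 C2 : R, [/\ 0 < C1, 0 < C2 &
    forall t : R, 0 <= t -> C1 * Phi t <= Psi t /\ Psi t <= C2 * Phi t].

Definition p_ominus Phi : R :=
  sup [set p_minus Psi | Psi in [set Psi | orlicz Psi /\ orlicz_equiv Psi Phi]].

Definition p_oplus Phi : R :=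
  inf [set p_plus Psi | Psi in [set Psi | orlicz Psi /\ orlicz_equiv Psi Phi]].

Definition p_ominus_attained_at Phi Psi : Prop :=
  [/\ orlicz Psi, orlicz_equiv Psi Phi & p_ominus Phi = p_minus Psi].

Definition p_oplus_attained_at Phi Psi : Prop :=
  [/\ orlicz Psi, orlicz_equiv Psi Phi & p_oplus Phi = p_plus Psi].

Definition p_oplus_attained Phi : Prop :=
  exists Psi, p_oplus_attained_at Phi Psi.

End orlicz.

(* The integral of Phi(|x|^a1 |y|^a2 |D_s u(x, y)|) against the measure
   dx dy / |x - y|^n.  For n >= 1 the points with x = 0, y = 0 or x = y form a
   null set, so the conventional values of the integrand there (0 `^ a and
   division by 0 are total) do not matter. *)
Definition weighted_energy (R : realType) (n : nat) (s a1 a2 : R)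
    (Phi : R -> R) (u : 'rV[R]_n -> R) : \bar R :=
  (\int[lebesgue_rV R n \x lebesgue_rV R n]_p
    (Phi (enorm p.1 `^ a1 * enorm p.2 `^ a2 *
          `|holder_quotient s u p.1 p.2|)
     / enorm (p.1 - p.2) ^+ n)%:E)%E.

(* Main.v *)
Require Import Defs.
From mathcomp Require Import all_boot all_order all_algebra.
From mathcomp Require Import all_classical all_reals all_analysis.
From mathcomp Require Import measurable_realfun ring lra.

Import Order.TTheory GRing.Theory Num.Theory.
Import numFieldNormedType.Exports.

Local Open Scope classical_set_scope.
Local Open Scope ring_scope.

Set Implicit Arguments.
Unset Strict Implicit.
Unset Printing Implicit Defensive.

(** Fix an Orlicz function [Psi] equivalent to [Phi] that attains the index, and
let [q = p_plus Psi].  Cut space into the sup-norm shells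
[S_n = {a_n <= |x| < 2 a_n}], where [a_n] is a geometric progression of ratio
1/2 when the support lies inside the ball, and of ratio 2 when it lies outside.
Let [G_n] be the integral of [Psi (a_n^-gamma |u|)] over [S_n].

For [x] in [S_(n+1)], [y] in [S_n] and any [th] in (0, 1), convexity and the
growth bound [Psi (l t) <= l^q Psi t] for [l >= 1] give, after scaling the
arguments by [a_(n+1)^-gamma],
[Psi |u x| <= th^(1-q) Psi |u y| + (1-th)^(1-q) Psi |u x - u y|]
([orlicz_quasi_add]).  Integrating over [S_(n+1)] and [S_n] yields
[G_(n+1) <= th^(1-q) G_n + K (1-th)^(1-q) D_n] ([shell_mass_step]), where [D_n]
is the mean oscillation of [u] between the two shells.  The coefficient of
[G_n] is [th^(1-q)] without any further constant: the critical value of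
[gamma] is the one for which the change of [Psi] under a dyadic scaling cancels
the ratio of the volumes of consecutive shells.

On [S_(n+1) x S_n] the weights and the kernel are at least a constant times their
value at scale [a_n], and these products are disjoint, so that the sum of the
[D_n] is at most a constant times the energy ([sum_shell_osc_le]).  Pairing points of
different shells takes the place of a Poincare inequality on each shell.

The support condition says that [G_0 = 0].  The recursion, used with
[th = 1 - 1 / (2 (n+1))], is then a discrete Hardy inequality and gives that
the sum of [n^-q G_n] is at most a constant times the sum of the [D_n]
([discrete_hardy]).  On [S_n] the logarithm in the statement is at least [b n],
which turns [n^-q] into the logarithmic weight ([critical_shell_hardy]).

The growth bounds come from the definition of the indices, which are
differential inequalities for the right derivative.  They say that [Psi t / t^q]
is multiplied by at least [1 - M y^2] when [ln t] decreases by [y], and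
[Psi t / t^p], with [p = p_minus Psi], when [ln t] increases by [y]; cutting an
interval into [m] equal steps shows that the total loss is O(1/m), hence zero
([nondecreasing_of_quadratic_loss]). *)

(** * Growth of Orlicz functions *)

Section orlicz_function.
Context (R : realType) (F : R -> R).
Hypothesis oF : orlicz F.

Lemma orlicz_ge0 t : 0 <= t -> 0 <= F t.
Proof. by case: oF => + _ _ _ _; apply. Qed.

Lemma orlicz_convex (x y t : R) : 0 <= x -> 0 <= y -> 0 <= t -> t <= 1 ->
  F (t * x + (1 - t) * y) <= t * F x + (1 - t) * F y.
Proof.
move=> x0 y0 t0 t1; case: oF => _ _ cF _ _.
have := cF (Itv01 t0 t1) x y.
rewrite !inE /= !in_itv /= !andbT => /(_ x0 y0).
by rewrite !convRE.
Qed.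

Lemma orlicz_three_points (a b c : R) : 0 <= a -> a <= b -> b <= c ->
  F b * (c - a) <= F a * (c - b) + F c * (b - a).
Proof.
move=> a0; rewrite le_eqVlt => /predU1P[<-|ab]; first by rewrite subrr mulr0 addr0.
rewrite le_eqVlt => /predU1P[<-|bc]; first by rewrite subrr mulr0 add0r.
have ca : 0 < c - a by lra.
have := @orlicz_convex a c ((c - b) / (c - a)).
have -> : 1 - (c - b) / (c - a) = (b - a) / (c - a) by field; lra.
have -> : (c - b) / (c - a) * a + (b - a) / (c - a) * c = b by field; lra.
rewrite ler_pdivrMr// mul1r => H.
rewrite -ler_pdivlMr//.
have -> : (F a * (c - b) + F c * (b - a)) / (c - a) =
  (c - b) / (c - a) * F a + (b - a) / (c - a) * F c by field; lra.
by apply: H; rewrite ?divr_ge0//; lra.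
Qed.

(** Convexity alone allows a jump at 0: it is continuity that transports the limit
of [F t = (F t / t) * t] to the value at 0. *)
Lemma orlicz0 : F 0 = 0.
Proof.
case: oF => _ /continuous_within_itvcyP[_ F0] _ [F't _] _.
have F'0 : F t @[t --> (0:R)^'+] --> (0:R).
  have idc : t @[t --> (0:R)^'+] --> (0:R) by exact: cvg_at_right_filter.
  rewrite -[X in _ --> X](mulr0 0).
  apply: cvg_trans (cvgM F't idc); apply: near_eq_cvg.
  near=> t; rewrite /= mulfVK// gt_eqF//.
by apply: norm_cvg_unique F0 F'0.
Unshelve. all: by end_near. Qed.

Lemma orlicz_nondecreasing (a b : R) : 0 <= a -> a <= b -> F a <= F b.
Proof.
move=> a0 ab; have [b0|b0] := eqVneq b 0; first by rewrite (_ : a = b)//; lra.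
have bp : 0 < b by lra.
have := orlicz_three_points (lexx 0) a0 ab; rewrite orlicz0.
rewrite mul0r add0r !subr0 => H; rewrite -(ler_pM2r bp) (le_trans H)//.
by rewrite ler_wpM2l// orlicz_ge0// ltW.
Qed.

(** A zero of [F] would propagate to arbitrarily large arguments by the
doubling condition, contradicting superlinear growth. *)
Lemma orlicz_gt0 t : 0 < t -> 0 < F t.
Proof.
move=> t0; rewrite lt_def orlicz_ge0 ?andbT ?ltW//; apply/eqP => Ft.
have F2 n : F (2 ^+ n * t) = 0.
  elim: n => [|n IHn]; first by rewrite expr0 mul1r.
  have tn m : 0 <= 2 ^+ m * t by rewrite mulr_ge0 ?exprn_ge0// ltW.
  case: oF => _ _ _ _ [C _ /(_ _ (tn n))].
  rewrite IHn mulr0 mulrA -exprS => Fn.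
  by apply/eqP; rewrite eq_le Fn orlicz_ge0.
case: oF => _ _ _ [_ /cvgryPge/(_ 1) [M [_ HM]]] _.
set x := Num.max (M + 1) 1.
have Mx : M < x by rewrite lt_max ltrDl ltr01.
have x0 : 0 < x by rewrite lt_max ltr01 orbT.
have := HM _ Mx; rewrite ler_pdivlMr// mul1r => xF.
have [n xn] : exists n, x <= 2 ^+ n * t.
  exists (Num.bound (x / t)).
  by rewrite -ler_pdivrMr// ltW// upper_nthrootP.
have := orlicz_nondecreasing (ltW x0) xn; rewrite F2; lra.
Qed.

(** The difference quotients at [t] decrease with the step and are bounded below by
the slopes on the left of [t], so the right derivative is their infimum. *)
Lemma right_derivative_bounds (t : R) : 0 < t ->
  (forall h, 0 < h -> right_derivative F t <= (F (t + h) - F t) / h) /\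
  (forall s, 0 <= s -> s < t -> (F t - F s) / (t - s) <= right_derivative F t).
Proof.
move=> t0; set q := fun h => (F (t + h) - F t) / h.
have slope s h : 0 <= s -> s < t -> 0 < h -> (F t - F s) / (t - s) <= q h.
  move=> s0 st h0; rewrite ler_pdivrMr ?subr_gt0// /q mulrAC ler_pdivlMr//.
  have := @orlicz_three_points s t (t + h) s0 (ltW st) ltac:(lra); nra.
have lbq : lbound [set q h | h in `]0, +oo[] ((F t - F 0) / (t - 0)).
  by move=> _ [h /=] + <-; rewrite in_itv/= andbT => h0; exact: slope.
have ndq : {in `](0:R), +oo[ &, {homo q : n m / n <= m}}.
  move=> h k; rewrite !in_itv/= !andbT => h0 k0 hk.
  rewrite ler_pdivrMr// /q mulrAC ler_pdivlMr//.
  have := @orlicz_three_points t (t + h) (t + k) (ltW t0) ltac:(lra) ltac:(lra); nra.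
have /cvg_lim : q h @[h --> 0^'+] --> inf [set q h | h in `]0, +oo[].
  by apply: nondecreasing_at_right_cvgr => //; exists ((F t - F 0) / (t - 0)).
rewrite /right_derivative -/q => ->//; split => [h h0|s s0 st].
  by apply: ge_inf; [exists ((F t - F 0) / (t - 0))|exists h; rewrite //= in_itv/= h0].
apply: lb_le_inf; first by exists (q 1), 1; rewrite //= in_itv/= ltr01.
by move=> _ [h /=] + <-; rewrite in_itv/= andbT; exact: slope.
Qed.

(** By doubling, [t * right_derivative F t <= F (2 t) - F t <= (C - 1) F t]; the
supremum is therefore taken over a bounded set. *)
Lemma mul_right_derivative_le t : 0 < t -> t * right_derivative F t <= p_plus F * F t.
Proof.
move=> t0; rewrite -ler_pdivrMr ?orlicz_gt0//; apply: ub_le_sup; last first.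
  by exists t => //=; rewrite in_itv/= t0.
case: oF => _ _ _ _ [C _ FC]; exists (C - 1) => _ [x /=] + <-.
rewrite in_itv/= andbT => x0; rewrite ler_pdivrMr ?orlicz_gt0//.
have [/(_ x x0) + _] := right_derivative_bounds x0.
by rewrite ler_pdivlMr//; have := FC x (ltW x0); rewrite (_ : 2 * x = x + x); nra.
Qed.

Lemma orlicz_index_ge1 t : 0 < t -> 1 <= orlicz_index F t.
Proof.
move=> t0; have [_ /(_ 0 (lexx _) t0)] := right_derivative_bounds t0.
rewrite orlicz0 !subr0 ler_pdivrMr// => H.
by rewrite ler_pdivlMr ?orlicz_gt0// mul1r mulrC.
Qed.

Lemma p_minus_ge1 : 1 <= p_minus F.
Proof.
apply: lb_le_inf; first by exists (orlicz_index F 1), 1; rewrite //= in_itv/= ltr01.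
by move=> _ [t /=] + <-; rewrite in_itv/= andbT; exact: orlicz_index_ge1.
Qed.

Lemma mul_right_derivative_ge t : 0 < t -> p_minus F * F t <= t * right_derivative F t.
Proof.
move=> t0; rewrite -ler_pdivlMr ?orlicz_gt0//; apply: ge_inf; last first.
  by exists t => //=; rewrite in_itv/= t0.
exists 1 => _ [x /=] + <-.
by rewrite in_itv/= andbT; exact: orlicz_index_ge1.
Qed.

End orlicz_function.

Lemma bernoulli_exprn (R : realDomainType) (x : R) n : 0 <= x -> x <= 1 ->
  1 - n%:R * x <= (1 - x) ^+ n.
Proof.
move=> x0 x1; elim: n => [|n IHn]; first by rewrite mul0r subr0 expr0.
rewrite exprS; apply: le_trans (ler_wpM2l _ IHn); last lra.
rewrite -[n.+1]addn1 natrD mulrDl mul1r.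
have : 0 <= n%:R * x * x by rewrite !mulr_ge0.
lra.
Qed.

(** Over [m] equal steps of an interval of length [L] the total relative loss is at
most [M L^2 / m], which is arbitrarily small; no derivative of [k] has to
exist. *)
Lemma nondecreasing_of_quadratic_loss (R : realType) (k : R -> R) (M : R) :
  (forall v, 0 <= k v) ->
  (forall v y, 0 <= y -> k v * (1 - M * y ^+ 2) <= k (v + y)) ->
  {homo k : v w / v <= w}.
Proof.
move=> k0 kM v w vw; set L := w - v; have L0 : 0 <= L by rewrite subr_ge0.
wlog M0 : M kM / 0 <= M.
  move=> /(_ (Num.max M 0)); apply; last by rewrite le_max lexx orbT.
  move=> v' y y0; apply: le_trans (kM v' y y0); apply: ler_wpM2l => //.
  by rewrite lerD2l lerN2 ler_wpM2r ?sqr_ge0// le_max lexx.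
set c := M * L ^+ 2; have c0 : 0 <= c by rewrite mulr_ge0// sqr_ge0.
have step m : c <= m.+1%:R -> k v * (1 - c / m.+1%:R) <= k w.
  move=> cm; have m0 : 0 < m.+1%:R :> R by [].
  set x := c / m.+1%:R ^+ 2.
  have x0 : 0 <= x by rewrite divr_ge0// exprn_ge0.
  have x1 : x <= 1.
    rewrite ler_pdivrMr ?exprn_gt0// mul1r (le_trans cm)// ler_eXnr// ler1n//.
  have H i : k v * (1 - x) ^+ i <= k (v + i%:R * (L / m.+1%:R)).
    elim: i => [|i IHi]; first by rewrite expr0 mulr1 mul0r addr0.
    set y := L / m.+1%:R; have y0 : 0 <= y by rewrite divr_ge0.
    have := kM (v + i%:R * y) _ y0.
    rewrite -addrA -[X in _ + (_ + X)]mul1r -mulrDl natr1.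
    apply: le_trans.
    rewrite (_ : M * y ^+ 2 = x); last by rewrite /x /c expr_div_n mulrA.
    by rewrite exprSr mulrA ler_wpM2r// subr_ge0.
  have := H m.+1; rewrite mulrCA divff ?mulr1; last by rewrite gt_eqF.
  rewrite (_ : v + L = w) /L; last lra.
  apply: le_trans; apply: ler_wpM2l => //.
  apply: le_trans (bernoulli_exprn _ x0 x1).
  by rewrite /x lerD2l lerN2 expr2 invfM mulrCA [X in c * X <= _]mulrA divff ?mul1r// gt_eqF.
apply/ler_addgt0Pr => e e0.
set m := Num.bound (c + k v * c / e).
have kce : 0 <= k v * c / e by rewrite divr_ge0 ?mulr_ge0// ltW.
have mb : c + k v * c / e < m%:R by apply: archi_boundP; rewrite addr_ge0.
have mS : m%:R <= m.+1%:R :> R by rewrite ler_nat.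
have cm : c <= m.+1%:R.
  by apply: (le_trans _ mS); apply: (le_trans _ (ltW mb)); rewrite lerDl.
have m0 : 0 < m.+1%:R :> R by [].
have small : k v * (c / m.+1%:R) <= e.
  rewrite mulrA ler_pdivrMr// [leRHS]mulrC -ler_pdivrMr//.
  by apply: (le_trans _ mS); apply: (le_trans _ (ltW mb)); rewrite lerDr.
have := step _ cm; rewrite mulrBr mulr1 lerBlDr => /le_trans; apply.
by rewrite lerD2l.
Qed.

Section orlicz_growth.
Context (R : realType) (F : R -> R).
Hypothesis oF : orlicz F.

(** [F t / t^q] is nonincreasing for [q = p_plus F]; the quadratic loss is that of
[(1 - q y) (1 + q y)], one factor for [F] and one for the power. *)
Lemma orlicz_growth (l t : R) : 1 <= l -> 0 <= t ->
  F (l * t) <= l `^ p_plus F * F t.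
Proof.
move=> l1; rewrite le_eqVlt => /predU1P[t0|t0]; first by rewrite -t0 mulr0 orlicz0// mulr0.
have l0 : 0 < l by lra.
set q := p_plus F.
(* F t / t ^ q in the variable v = - ln t, in which it is nondecreasing *)
pose k (v : R) := F (expR (- v)) * expR (q * v).
have k0 v : 0 <= k v by rewrite mulr_ge0 ?expR_ge0 ?(orlicz_ge0 oF) ?expR_ge0.
have kM v y : 0 <= y -> k v * (1 - q ^+ 2 * y ^+ 2) <= k (v + y).
  rewrite le_eqVlt => /predU1P[<-|y0]; first by rewrite expr0n/= mulr0 subr0 mulr1 addr0.
  have [qy|qy] := leP 1 (q * y).
    apply: le_trans (k0 _); apply: mulr_ge0_le0 => //.
    by rewrite subr_le0 -exprMn expr_ge1//; nra.
  have q0 : 0 <= q.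
    have := mul_right_derivative_le oF ltr01; have := mul_right_derivative_ge oF ltr01.
    have := p_minus_ge1 oF; have := orlicz_gt0 oF ltr01; rewrite -/q; nra.
  set s := expR (- v); set t' := expR (- (v + y)).
  have s0 : 0 < s by exact: expR_gt0.
  have st : t' = s * expR (- y) by rewrite /t' opprD expRD.
  have y1 : expR (- y) < 1 by rewrite expR_lt1; lra.
  have ey : 1 - y <= expR (- y) by rewrite expR_ge1Dx.
  have t'0 : 0 < t' by exact: expR_gt0.
  have [_ /(_ t' (ltW t'0))] := right_derivative_bounds oF s0.
  have ts : t' < s by rewrite st; nra.
  move=> /(_ ts); rewrite ler_pdivrMr ?subr_gt0// => Hs.
  have Hq := mul_right_derivative_le oF s0; rewrite -/q in Hq.
  have Fs : 0 <= F s by apply: orlicz_ge0 => //; exact: ltW.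
  have main : F s * (1 - q * y) <= F t'.
    have : (s - t') * right_derivative F s <= y * (q * F s).
      have -> : s - t' = s * (1 - expR (- y)) by rewrite st; ring.
      rewrite mulrAC (le_trans (ler_wpM2r _ Hq))//; first lra.
      rewrite mulrC ler_wpM2r ?mulr_ge0//; lra.
    nra.
  rewrite /k -/s -/t' (mulrDr q) expRD mulrA.
  have -> : F s * expR (q * v) * (1 - q ^+ 2 * y ^+ 2) =
    (F s * (1 - q * y)) * expR (q * v) * (1 + q * y) by ring.
  apply: ler_pM => //.
  - by rewrite !mulr_ge0 ?expR_ge0//; lra.
  - by rewrite addr_ge0// mulr_ge0// ltW.
  - by rewrite ler_wpM2r ?expR_ge0.
  - exact: expR_ge1Dx.
have lt0 : 0 < l * t by rewrite mulr_gt0.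
have := @nondecreasing_of_quadratic_loss _ k _ k0 kM (- ln (l * t)) (- ln t).
rewrite lerN2 ler_ln ?posrE// ler_peMl ?(ltW t0)// => /(_ isT).
rewrite /k !opprK !lnK ?posrE// lnM ?posrE// mulrN mulrDr opprD expRD => H.
rewrite /powR gt_eqF//.
have := ler_wpM2r (expR_ge0 (q * ln l + q * ln t)) H.
rewrite !mulrN -mulrA -!expRD.
rewrite (_ : - (q * ln l) + - (q * ln t) + _ = 0); last ring.
rewrite -mulrA -!expRD (_ : - (q * ln t) + (q * ln l + q * ln t) = q * ln l); last ring.
by rewrite expR0 mulr1 [X in _ <= X]mulrC.
Qed.

(** The dual fact: [F t / t^p] is nondecreasing for [p = p_minus F]. *)
Lemma orlicz_growth_le1 (l t : R) : 0 < l -> l <= 1 -> 0 <= t ->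
  F (l * t) <= l `^ p_minus F * F t.
Proof.
move=> l0 l1; rewrite le_eqVlt => /predU1P[t0|t0]; first by rewrite -t0 mulr0 orlicz0// mulr0.
set p := p_minus F; have p1 : 1 <= p by exact: p_minus_ge1.
pose k (v : R) := F (expR v) * expR (- (p * v)).
have k0 v : 0 <= k v by rewrite mulr_ge0 ?expR_ge0 ?(orlicz_ge0 oF) ?expR_ge0.
have kM v y : 0 <= y -> k v * (1 - p ^+ 2 * y ^+ 2) <= k (v + y).
  rewrite le_eqVlt => /predU1P[<-|y0]; first by rewrite expr0n/= mulr0 subr0 mulr1 addr0.
  have [py|py] := leP 1 (p * y).
    apply: le_trans (k0 _); apply: mulr_ge0_le0 => //.
    by rewrite subr_le0 -exprMn expr_ge1//; nra.
  set s := expR v; set t' := expR (v + y).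
  have s0 : 0 < s by exact: expR_gt0.
  have st : t' = s * expR y by rewrite /t' expRD.
  have ey : 1 + y <= expR y by rewrite expR_ge1Dx.
  have [/(_ (t' - s)) + _] := right_derivative_bounds oF s0.
  have ts : 0 < t' - s by rewrite st; nra.
  move=> /(_ ts); rewrite ler_pdivlMr// (_ : s + (t' - s) = t'); last lra.
  move=> Hs; have Hp := mul_right_derivative_ge oF s0; rewrite -/p in Hp.
  have Fs : 0 <= F s by apply: orlicz_ge0 => //; exact: ltW.
  have main : F s * (1 + p * y) <= F t'.
    have : y * (p * F s) <= right_derivative F s * (t' - s).
      have -> : right_derivative F s * (t' - s) =
        (expR y - 1) * (s * right_derivative F s) by rewrite st; ring.
      apply: ler_pM => //; last lra; first exact: ltW.
      by rewrite mulr_ge0//; lra.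
    nra.
  rewrite /k -/s -/t' (mulrDr p) opprD expRD mulrA.
  have -> : F s * expR (- (p * v)) * (1 - p ^+ 2 * y ^+ 2) =
    (F s * (1 + p * y)) * expR (- (p * v)) * (1 - p * y) by ring.
  apply: ler_pM => //.
  - by rewrite !mulr_ge0 ?expR_ge0//; nra.
  - lra.
  - by rewrite ler_wpM2r ?expR_ge0.
  - exact: expR_ge1Dx.
have lt0 : 0 < l * t by rewrite mulr_gt0.
have := @nondecreasing_of_quadratic_loss _ k _ k0 kM (ln (l * t)) (ln t).
rewrite ler_ln ?posrE// ler_piMl ?(ltW t0)// => /(_ isT).
rewrite /k !lnK ?posrE// lnM ?posrE// mulrDr opprD expRD => H.
rewrite /powR gt_eqF//.
have := ler_wpM2r (expR_ge0 (p * ln l + p * ln t)) H.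
rewrite -mulrA -!expRD.
rewrite (_ : - (p * ln l) + - (p * ln t) + _ = 0); last ring.
rewrite -mulrA -!expRD (_ : - (p * ln t) + (p * ln l + p * ln t) = p * ln l); last ring.
by rewrite expR0 mulr1 [X in _ <= X]mulrC.
Qed.

(** With exponent at most 1 the growth bound would be linear. *)
Lemma p_plus_gt1 : 1 < p_plus F.
Proof.
rewrite ltNge; apply/negP => q1.
case: (oF) => _ _ _ [_ /cvgryPge/(_ (F 1 + 1)) [M [_ HM]]] _.
set x := Num.max (M + 1) 1.
have Mx : M < x by rewrite lt_max ltrDl ltr01.
have x1 : 1 <= x by rewrite le_max lexx orbT.
have x0 : 0 < x by lra.
have := HM _ Mx; rewrite ler_pdivlMr//.
have := orlicz_growth x1 ler01; rewrite mulr1.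
have := ler_powR x1 q1; rewrite powRr1 ?(ltW x0)// => /ler_wpM2r.
move=> /(_ (F 1) (orlicz_ge0 oF ler01)); nra.
Qed.

(** Write [a + b] as the convex combination of [a / th] and [b / (1 - th)], and undo
both dilations by the growth bound.  The coefficient of [F a] tends to 1 as [th]
tends to 1, which is what makes the summation over scales possible. *)
Lemma orlicz_quasi_add (th a b : R) : 0 < th -> th < 1 -> 0 <= a -> 0 <= b ->
  F (a + b) <= th `^ (1 - p_plus F) * F a + (1 - th) `^ (1 - p_plus F) * F b.
Proof.
move=> th0 th1 a0 b0; set q := p_plus F.
have piece (x c : R) : 0 < x -> x < 1 -> 0 <= c -> x * F (c / x) <= x `^ (1 - q) * F c.
  move=> x0 x1 c0.
  have := @orlicz_growth x^-1 c; rewrite invf_ge1// => /(_ (ltW x1) c0).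
  rewrite [x^-1 * c]mulrC => /(ler_wpM2l (ltW x0)) /le_trans; apply.
  rewrite powRD; last by rewrite (gt_eqF x0) implybT.
  rewrite powRr1 ?(ltW x0)// -powR_inv1 ?(ltW x0)//.
  by rewrite -powRrM mulN1r mulrA.
have := @orlicz_convex _ _ oF (a / th) (b / (1 - th)) th.
rewrite (_ : th * _ + _ = a + b); last by field; lra.
have t1 : 0 < 1 - th by lra.
move=> /(_ (divr_ge0 a0 (ltW th0)) (divr_ge0 b0 (ltW t1)) (ltW th0) (ltW th1)).
move=> /le_trans; apply.
by apply: lerD; apply: piece => //; lra.
Qed.

End orlicz_growth.

(** * A discrete Hardy inequality *)

(** A discrete form, over a half step, of the derivative [(1-q) m^-q] of [m^(1-q)]. *)
Lemma powR_gap (R : realType) (q m : R) : 1 < q -> 1 <= m ->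
  (q - 1) / (3 * q) * m `^ (- q) + (m + 2^-1) `^ (1 - q) <= m `^ (1 - q).
Proof.
move=> q1 m1; have m0 : 0 < m by lra.
set d := q - 1; have d0 : 0 < d by rewrite /d; lra.
have mh : 0 < m + 2^-1 by lra.
set y := d / (3 * m); have y0 : 0 < y by rewrite divr_gt0//; lra.
have lnb : y <= d * (ln (m + 2^-1) - ln m).
  have z0 : 0 < m / (m + 2^-1) by rewrite divr_gt0.
  have := @le_ln1Dx R (m / (m + 2^-1) - 1) ltac:(lra).
  rewrite addrC subrK ln_div ?posrE// => H.
  rewrite /y ler_pM2l//; apply: (@le_trans _ _ (1 - m / (m + 2^-1))); last lra.
  rewrite -[X in _ <= X](_ : (2 * m + 1)^-1 = _); last by field; lra.
  by rewrite lef_pV2 ?posrE; lra.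
have key : (m + 2^-1) `^ (1 - q) <= m `^ (1 - q) * (1 + y)^-1.
  rewrite /powR !gt_eqF//.
  have -> : (1 - q) * ln (m + 2^-1) =
    (1 - q) * ln m - d * (ln (m + 2^-1) - ln m) by rewrite /d; ring.
  rewrite expRD ler_wpM2l ?expR_ge0// expRN lef_pV2 ?posrE ?expR_gt0//; last lra.
  by apply: le_trans (expR_ge1Dx _) _; rewrite ler_expR.
have mq : m `^ (1 - q) = m * m `^ (- q).
  by rewrite powRD ?powRr1 ?(ltW m0)// (gt_eqF m0) implybT.
have P0 : 0 < m `^ (- q) by exact: powR_gt0.
apply: (@le_trans _ _ (d / (3 * q) * m `^ (- q) + m `^ (1 - q) * (1 + y)^-1)).
  by rewrite lerD2l.
rewrite mq [m * _ * _]mulrAC -mulrDl ler_wpM2r ?(ltW P0)//.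
have -> : m * (1 + y)^-1 = m - d / (3 * (1 + y)).
  by rewrite /y; field; rewrite ?gt_eqF//=; nra.
have ym : y <= d by rewrite ler_pdivrMr; nra.
suff : d / (3 * q) <= d / (3 * (1 + y)) by lra.
by rewrite ler_pM2l// lef_pV2 ?posrE; rewrite /d in ym *; lra.
Qed.

(** Multiply the recursion by [(n+1)^(1-q)] and take [th = 1 - 1 / (2 (n+1))].  The
coefficient of [D n] becomes constant, while that of [G n] becomes
[(n + 1/2)^(1-q)], which is smaller than the weight [n^(1-q)] carried by [G n] in
the previous step; by [powR_gap] the difference is at least a multiple of [n^-q],
and it is what remains after telescoping. *)
Lemma discrete_hardy (R : realType) (q K : R) (G D : nat -> R) :
  1 < q -> (forall n, 0 <= G n) -> G 0%N = 0 ->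
  (forall n th, 0 < th -> th < 1 ->
     G n.+1 <= th `^ (1 - q) * G n + K * (1 - th) `^ (1 - q) * D n) ->
  forall M, (q - 1) / (3 * q) * (\sum_(n < M) n.+1%:R `^ (- q) * G n.+1) <=
    K * 2 `^ (q - 1) * \sum_(n < M) D n.
Proof.
move=> q1 G0 G00 GD M; set c := (q - 1) / (3 * q); set K' := K * _.
(* the second term is the part of the weight that the next step consumes *)
suff H : c * (\sum_(n < M) n.+1%:R `^ (- q) * G n.+1) +
    (M%:R + 2^-1) `^ (1 - q) * G M <= K' * \sum_(n < M) D n.
  by apply: le_trans H; rewrite lerDl mulr_ge0// powR_ge0.
elim: M => [|M IH]; first by rewrite !big_ord0 G00 !mulr0 addr0.
move: IH.
rewrite !big_ord_recr /= !mulrDr.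
have [m mE] : exists m : R, m = M.+1%:R by exists M.+1%:R.
have m1 : 1 <= m by rewrite mE ler1n.
have mM : M%:R = m - 1 by rewrite mE -natr1 addrK.
rewrite -mE mM => IH.
have m0 : 0 < m by lra.
pose th := 1 - (2 * m)^-1.
have h0 : 0 < (2 * m)^-1 by rewrite invr_gt0; lra.
have h1 : (2 * m)^-1 < 1 by rewrite invf_lt1; lra.
have t0 : 0 < th by rewrite /th; lra.
have t1 : th < 1 by rewrite /th; lra.
have := GD M th t0 t1; rewrite /th opprB addrCA subrr addr0 => /(ler_wpM2l (powR_ge0 m (1 - q))).
rewrite mulrDr !mulrA -powRM ?(ltW m0)//; last lra.
have -> : m * (1 - (2 * m)^-1) = m - 1 + 2^-1 by field; lra.
rewrite [_ `^ _ * K]mulrC -[K * _ * _]mulrA -powRM ?(ltW m0) ?(ltW h0)//.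
have -> : m * (2 * m)^-1 = 2^-1 by field; lra.
have -> : 2^-1 `^ (1 - q) = 2 `^ (q - 1) :> R.
  by rewrite -powR_inv1// -powRrM; congr (_ `^ _); ring.
rewrite -/K' => H.
have gap := powR_gap q1 m1; rewrite -/c in gap.
have := ler_wpM2r (G0 M.+1) gap; rewrite mulrDl => gapG.
lra.
Qed.

Section ereal_hardy.
Local Open Scope ereal_scope.

(** If all [D n] are finite, the recursion makes all [G n] finite, starting from
[G 0 = 0]; otherwise the right-hand side is infinite. *)
Lemma discrete_hardy_ereal (R : realType) (q K : R) (G D : nat -> \bar R) :
  (1 < q)%R -> (0 < K)%R ->
  (forall n, 0 <= G n) -> (forall n, 0 <= D n) -> G 0%N = 0 ->
  (forall n th, (0 < th)%R -> (th < 1)%R ->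
     G n.+1 <= (th `^ (1 - q))%:E * G n + (K * (1 - th) `^ (1 - q))%:E * D n) ->
  \sum_(0 <= n <oo) (n.+1%:R `^ (- q))%:E * G n.+1 <=
    (K * 2 `^ (q - 1) * (3 * q / (q - 1)))%:E * \sum_(0 <= n <oo) D n.
Proof.
move=> q1 K0 G0 D0 G00 GD; set C := (K * _ * _)%R.
have C0 : (0 < C)%R by rewrite !mulr_gt0 ?powR_gt0// ?invr_gt0; lra.
have [DF|] := pselect (forall n, D n \is a fin_num); last first.
  move=> /existsNP[n /negP Dn].
  suff -> : \sum_(0 <= n <oo) D n = +oo by rewrite gt0_muley ?leey.
  apply/eqP; rewrite -leye_eq (_ : +oo = D n).
    by apply: le_trans (nneseries_lim_ge n.+1 _) => //; rewrite big_nat_recr//= leeDr// sume_ge0.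
  by move: Dn; rewrite ge0_fin_numE// -leNgt leye_eq => /eqP.
have GF n : G n \is a fin_num.
  elim: n => [|n IHn]; first by rewrite G00.
  have h0 : (0 < 2^-1 :> R)%R by lra.
  have h1 : (2^-1 < 1 :> R)%R by lra.
  rewrite ge0_fin_numE//; apply: (le_lt_trans (GD n _ h0 h1)).
  by rewrite -(fineK IHn) -(fineK (DF n)) -!EFinM -EFinD ltry.
rewrite -nneseriesZl//.
have := @discrete_hardy R q K (fine \o G) (fine \o D) q1.
move=> /(_ (fun n => fine_ge0 (G0 n))); rewrite /= G00 => /(_ erefl).
have GD' n th : (0 < th)%R -> (th < 1)%R -> (fine (G n.+1) <=
    th `^ (1 - q) * fine (G n) + K * (1 - th) `^ (1 - q) * fine (D n))%R.
  move=> t0 t1; rewrite -lee_fin EFinD 2!EFinM !fineK//.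
  exact: GD.
move=> /(_ GD') H.
apply: lime_le; first by apply: is_cvg_nneseries => n _ _; rewrite mule_ge0// lee_fin powR_ge0.
near=> M; apply: le_trans (nneseries_lim_ge M _); last first.
  by move=> n _ _; rewrite mule_ge0// lee_fin ltW.
rewrite !big_mkord.
under eq_bigr do rewrite -(fineK (GF _)) -EFinM.
under [leRHS]eq_bigr do rewrite -(fineK (DF _)) -EFinM.
rewrite !sumEFin lee_fin -mulr_sumr.
have := H M; rewrite -ler_pdivlMl; last by rewrite divr_gt0//; lra.
move=> /le_trans; apply; rewrite /C.
by rewrite le_eqVlt; apply/orP; left; apply/eqP; rewrite invf_div; ring.
Unshelve. all: by end_near. Qed.

End ereal_hardy.

(** * Borel measurability and sup-norm shells in R^n *)

Section rV_measurability.
Context (R : realType) (N : nat).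

Lemma measurable_rV_box (A : 'I_N -> set R) : (forall i, measurable (A i)) ->
  measurable [set v : 'rV[R]_N | forall i, A i (v ord0 i)].
Proof.
move=> mA; rewrite (_ : [set _ | _] = \bigcap_(i in [set: 'I_N])
    ((fun v : 'rV[R]_N => v ord0 i) @^-1` A i)).
  apply: fin_bigcap_measurable => // i _; rewrite -[X in measurable X]setTI.
  exact: (@measurable_coord _ R N i measurableT _ (mA i)).
by apply/seteqP; split => v /= H i; [move=> _; exact: H|exact: H].
Qed.

(** The sigma-algebra is generated by the coordinates; every open set is the
countable union of the boxes with rational vertices that it contains. *)
Lemma open_measurable_rV (O : set 'rV[R]_N) : open O -> measurable O.
Proof.
move=> oO.
pose box (c : {ffun 'I_N -> rat * rat}) : set 'rV[R]_N :=
  [set v | forall i, v ord0 i \in `]ratr (c i).1, ratr (c i).2[ ].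
have -> : O = \bigcup_c [set v | box c v /\ box c `<=` O].
  apply/seteqP; split => [x Ox|x [c _ [cx]]]; last exact.
  have /nbhs_ballP[e /= e0 xeO] := open_nbhs_nbhs (conj oO Ox).
  have /fin_all_exists[c cP] (i : 'I_N) : exists p : rat * rat,
      x ord0 i - e < ratr p.1 < x ord0 i /\ x ord0 i < ratr p.2 < x ord0 i + e.
    have [q] := @rat_in_itvoo R (x ord0 i - e) (x ord0 i) ltac:(lra).
    have [q'] := @rat_in_itvoo R (x ord0 i) (x ord0 i + e) ltac:(lra).
    by rewrite !in_itv/=; exists (q, q').
  exists [ffun i => c i] => //; split => [i|y yc].
    by rewrite in_itv/= ffunE; have [/andP[_ ->] /andP[->]] := cP i.
  apply: xeO; split => // j i; rewrite (ord1 j) /ball/=.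
  have := yc i; rewrite in_itv/= ffunE => /andP[c1 c2].
  have [/andP[? ?] /andP[? ?]] := cP i.
  by rewrite ltr_norml; apply/andP; split; lra.
apply: countable_bigcupT_measurable; first exact: (@countableP {ffun 'I_N -> rat * rat}).
move=> c; have [cO|cO] := pselect (box c `<=` O); last first.
  by rewrite (_ : [set _ | _] = set0)//; apply/seteqP; split => // x [].
rewrite (_ : [set _ | _] = box c); last by apply/seteqP; split => // x [].
apply: (@measurable_rV_box (fun i => `]ratr (c i).1, ratr (c i).2[%classic)).
by move=> i; exact: measurable_itv.
Qed.

Lemma continuous_measurable_rV (u : 'rV[R]_N -> R) :
  continuous u -> measurable_fun [set: 'rV[R]_N] u.
Proof.
move=> /continuousP cu; apply: (measurability _ (RGenOpens.measurableE R)).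
move=> _ [_ [a [b ->] <-]]; rewrite setTI; apply: open_measurable_rV.
exact/cu/interval_open.
Qed.

Lemma measurable_enorm_comp d (T : measurableType d) (f : T -> 'rV[R]_N) :
  (forall i, measurable_fun [set: T] (fun x => f x ord0 i)) ->
  measurable_fun [set: T] (fun x => enorm (f x)).
Proof.
move=> mf; apply: (@measurableT_comp _ _ _ _ _ _ (@Num.sqrt R)).
  apply: nondecreasing_measurable => // x y; exact: ler_wsqrtr.
by apply: measurable_sum => i; exact: measurable_funX.
Qed.

Lemma measurable_enorm : measurable_fun [set: 'rV[R]_N] (@enorm R N).
Proof. by apply: measurable_enorm_comp => i; exact: measurable_coord. Qed.

End rV_measurability.

Section shells.
Context (R : realType) (N : nat).
Implicit Types (a : R) (x y : 'rV[R]_N).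

(** Cubes rather than Euclidean balls: their volume is a product, and only the ratio
of the volumes of consecutive shells has to be exact. *)
Definition cube a : set 'rV[R]_N := [set x | forall i, `|x ord0 i| < a].

Definition shell a : set 'rV[R]_N := cube (2 * a) `\` cube a.

Lemma measurable_cube a : measurable (cube a).
Proof.
apply: (@measurable_rV_box R N (fun=> [set t : R | `|t| < a])) => _.
rewrite (_ : [set _ | _] = `]- a, a[%classic); first exact: measurable_itv.
by apply/seteqP; split => t /=; rewrite in_itv/= ltr_norml.
Qed.

Lemma measurable_shell a : measurable (shell a).
Proof. by apply: measurableD; exact: measurable_cube. Qed.

Lemma subset_cube a b : a <= b -> cube a `<=` cube b.
Proof. by move=> ab x xa i; apply: lt_le_trans ab. Qed.

Lemma lebesgue_cube a : 0 < a -> lebesgue_rV R N (cube a) = ((2 * a) ^+ N)%:E.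
Proof.
move=> a0; have -> : cube a = [set v | forall i, `]- a, a[%classic (v ord0 i)].
  by apply/seteqP; split => v va i; have := va i; rewrite /= in_itv/= ltr_norml.
rewrite (@lebesgue_rV_box R N (fun=> `]- a, a[%classic))//.
rewrite (eq_bigr (fun=> (2 * a)%:E)) => [|i _].
  by rewrite prodEFin prodr_const card_ord.
rewrite lebesgue_measure_itv/= lte_fin ifT; last lra.
by rewrite -EFinD; congr (_%:E); ring.
Qed.

Lemma lebesgue_shell a : 0 < a ->
  lebesgue_rV R N (shell a) = ((4 ^+ N - 2 ^+ N) * a ^+ N)%:E.
Proof.
move=> a0; have aa : 0 < 2 * a by lra.
have mE : (lebesgue_rV R N (shell a) =
    lebesgue_rV R N (cube (2 * a)) - lebesgue_rV R N (cube a))%E.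
  rewrite -[in X in (_ - X)%E](@setIidr _ (cube (2 * a)) (cube a)); last first.
    by apply: subset_cube; lra.
  apply: measureD; try exact: measurable_cube.
  by rewrite [X in (X < _)%E](lebesgue_cube aa) ltry.
rewrite mE !lebesgue_cube// -EFinB; congr (_%:E).
rewrite mulrBl -!exprMn; congr (_ ^+ _ - _); ring.
Qed.

Lemma shell_disjoint a b x : 2 * a <= b -> shell a x -> shell b x -> False.
Proof. by move=> ab [xa _] [_]; apply; exact: subset_cube xa. Qed.

Lemma enorm_ge0 x : 0 <= enorm x.
Proof. exact: sqrtr_ge0. Qed.

Lemma enorm_cube a x : 0 <= a -> cube a x -> enorm x <= N%:R * a.
Proof.
move=> a0 xa; rewrite -[leRHS]ger0_norm ?mulr_ge0// -sqrtr_sqr ler_wsqrtr//.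
apply: (@le_trans _ _ (\sum_(i < N) a ^+ 2)).
  by apply: ler_sum => i _; rewrite -real_normK ?num_real// lerXn2r ?nnegrE// ltW.
rewrite sumr_const card_ord -[leLHS]mulr_natl exprMn ler_wpM2r ?sqr_ge0//.
by rewrite -natrX ler_nat; case: (N) => // n; rewrite leq_pmull.
Qed.

Lemma enorm_not_cube a x : 0 <= a -> ~ cube a x -> a <= enorm x.
Proof.
move=> a0 /existsNP[i /negP]; rewrite -leNgt => ai.
rewrite -[leLHS]ger0_norm// -sqrtr_sqr ler_wsqrtr//.
rewrite (bigD1 i)//= (@le_trans _ _ (x ord0 i ^+ 2))//.
  by rewrite -[leRHS]real_normK ?num_real// lerXn2r ?nnegrE.
by rewrite lerDl sumr_ge0// => j _; exact: sqr_ge0.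
Qed.

Lemma enorm_sub_cube a b x y : 0 <= a -> 0 <= b -> cube a x -> cube b y ->
  enorm (x - y) <= N%:R * (a + b).
Proof.
move=> a0 b0 xa yb; apply: enorm_cube; first by rewrite addr_ge0.
by move=> i; rewrite !mxE; apply: le_lt_trans (ler_normB _ _) _; exact: ltrD.
Qed.

Lemma enorm_gt0 x : x != 0 -> 0 < enorm x.
Proof.
move=> x0; rewrite lt_def enorm_ge0 andbT; apply: contra x0 => /eqP x0.
apply/eqP/rowP => i; rewrite mxE; apply: contrapT => /eqP xi.
have : ~ cube `|x ord0 i| x by move=> /(_ i); rewrite ltxx.
by move=> /enorm_not_cube; rewrite x0 => /(_ (normr_ge0 _)); rewrite normr_le0 (negbTE xi).
Qed.

End shells.

(** * Integrals over rectangles *)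

(** [F] is unconstrained on negative numbers, hence the truncation [max t 0], after
which [F] is monotone on the whole line. *)
Lemma measurable_orlicz_comp d (T : measurableType d) (R : realType)
    (F : R -> R) (f : T -> R) : orlicz F ->
  (forall x, 0 <= f x) -> measurable_fun [set: T] f ->
  measurable_fun [set: T] (fun x => F (f x)).
Proof.
move=> oF f0 mf.
rewrite (_ : (fun _ => _) = (fun t => F (Num.max t 0)) \o f); last first.
  by apply/funext => x /=; rewrite max_l.
apply: measurableT_comp => //; apply: nondecreasing_measurable => // t1 t2 t12.
apply: orlicz_nondecreasing => //; first by rewrite le_max lexx orbT.
by rewrite ge_max !le_max t12 lexx orbT.
Qed.

Section pairing.
Local Open Scope ereal_scope.
Context d1 d2 (T1 : measurableType d1) (T2 : measurableType d2) (R : realType).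
Context (m1 : {sigma_finite_measure set T1 -> \bar R}).
Context (m2 : {sigma_finite_measure set T2 -> \bar R}).
Variables (A : set T1) (B : set T2).
Hypotheses (mA : measurable A) (mB : measurable B).

(** The integrand is the restriction of a function of one variable to a rectangle,
so that the inner integral of Tonelli's theorem is one of a constant. *)
Lemma integral_setX_fst (f : T1 -> \bar R) : (forall x, 0 <= f x) ->
  measurable_fun [set: T1] f ->
  \int[m1 \x m2]_(z in A `*` B) f z.1 = m2 B * \int[m1]_(x in A) f x.
Proof.
move=> f0 mf; rewrite integral_mkcond.
have mAB : measurable (A `*` B) by exact: measurableX.
rewrite fubini_tonelli1; last 2 first.
- apply/(measurable_restrictT _ mAB)/measurable_funTS.
  exact: measurableT_comp.
- by move=> z; rewrite patchE; case: ifP.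
rewrite (eq_integral (fun x => m2 B * (f \_ A) x)) => [|x _]; last first.
  rewrite /fubini_F muleC -(integral_cst _ mB) [in RHS]integral_mkcond.
  apply: eq_integral => y _; rewrite !patchE /=.
  case: (pselect (A x)) => Ax; case: (pselect (B y)) => By.
  - by rewrite !mem_set.
  - by rewrite !memNset// => -[].
  - by rewrite [in LHS]memNset ?[x \in A]memNset ?mem_set// => -[].
  - by rewrite !memNset// => -[].
rewrite ge0_integralZl//; first by rewrite -integral_mkcond.
- exact/(measurable_restrictT _ mA)/measurable_funTS.
- by move=> x _; rewrite patchE; case: ifP.
Qed.

Lemma integral_setX_snd (g : T2 -> \bar R) : (forall y, 0 <= g y) ->
  measurable_fun [set: T2] g ->
  \int[m1 \x m2]_(z in A `*` B) g z.2 = m1 A * \int[m2]_(y in B) g y.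
Proof.
move=> g0 mg; rewrite integral_mkcond.
have mAB : measurable (A `*` B) by exact: measurableX.
rewrite fubini_tonelli2; last 2 first.
- apply/(measurable_restrictT _ mAB)/measurable_funTS.
  exact: measurableT_comp.
- by move=> z; rewrite patchE; case: ifP.
rewrite (eq_integral (fun y => m1 A * (g \_ B) y)) => [|y _]; last first.
  rewrite /fubini_G muleC -(integral_cst _ mA) [in RHS]integral_mkcond.
  apply: eq_integral => x _; rewrite !patchE /=.
  case: (pselect (A x)) => Ax; case: (pselect (B y)) => By.
  - by rewrite !mem_set.
  - by rewrite [in LHS]memNset ?[y \in B]memNset ?mem_set// => -[].
  - by rewrite !memNset// => -[].
  - by rewrite !memNset// => -[].
rewrite ge0_integralZl//; first by rewrite -integral_mkcond.
- exact/(measurable_restrictT _ mB)/measurable_funTS.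
- by move=> y _; rewrite patchE; case: ifP.
Qed.

Lemma integral_pairing (f : T1 -> R) (g : T2 -> R) (h : T1 * T2 -> R) (c1 c2 : R) :
  (forall x, (0 <= f x)%R) -> (forall y, (0 <= g y)%R) -> (forall z, (0 <= h z)%R) ->
  measurable_fun [set: T1] f -> measurable_fun [set: T2] g ->
  measurable_fun [set: T1 * T2] h -> (0 <= c1)%R -> (0 <= c2)%R ->
  (forall x y, A x -> B y -> (f x <= c1 * g y + c2 * h (x, y))%R) ->
  m2 B * \int[m1]_(x in A) (f x)%:E <=
    c1%:E * (m1 A * \int[m2]_(y in B) (g y)%:E) +
    c2%:E * \int[m1 \x m2]_(z in A `*` B) (h z)%:E.
Proof.
move=> f0 g0 h0 mf mg mh c10 c20 fgh.
have mAB : measurable (A `*` B) by exact: measurableX.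
rewrite -(integral_setX_fst (f := EFin \o f)) /=; last 2 first.
- by move=> x; rewrite lee_fin.
- exact/measurable_EFinP.
rewrite -(integral_setX_snd (g := EFin \o g)) /=; last 2 first.
- by move=> y; rewrite lee_fin.
- exact/measurable_EFinP.
have mf1 : measurable_fun [set: T1 * T2] (fun z => (f z.1)%:E).
  by apply/measurable_EFinP; exact: (measurableT_comp mf).
have mg2 : measurable_fun [set: T1 * T2] (fun z => (g z.2)%:E).
  by apply/measurable_EFinP; exact: (measurableT_comp mg).
have mhE : measurable_fun [set: T1 * T2] (fun z => (h z)%:E).
  exact/measurable_EFinP.
rewrite -ge0_integralZl//; last 2 first.
- exact: measurable_funTS.
- by move=> z _; rewrite lee_fin.
rewrite -ge0_integralZl//; last 2 first.
- exact: measurable_funTS.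
- by move=> z _; rewrite lee_fin.
have m1' : measurable_fun [set: T1 * T2] (fun z => c1%:E * (g z.2)%:E).
  exact: measurable_funeM.
have m2' : measurable_fun [set: T1 * T2] (fun z => c2%:E * (h z)%:E).
  exact: measurable_funeM.
rewrite -ge0_integralD//; last 4 first.
- by move=> z _; rewrite mule_ge0// lee_fin.
- exact: measurable_funTS.
- by move=> z _; rewrite mule_ge0// lee_fin.
- exact: measurable_funTS.
apply: ge0_le_integral => //.
- by move=> z _; rewrite lee_fin.
- exact: measurable_funTS.
- by apply: measurable_funTS; exact: emeasurable_funD.
- by move=> [x y] [/= Ax By]; rewrite -!EFinM -EFinD lee_fin; exact: fgh.
Qed.

End pairing.

(** * Lower bound for the energy density *)

(** In logarithms: [|ln t - ln a| <= ln K]. *)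
Lemma powR_comparable (R : realType) (K a t b : R) :
  1 <= K -> 0 < a -> a / K <= t -> t <= K * a ->
  K `^ (- `|b|) * a `^ b <= t `^ b.
Proof.
move=> K1 a0 t1 t2; have K0 : 0 < K by lra.
have t0 : 0 < t by apply: lt_le_trans t1; rewrite divr_gt0.
rewrite /powR !gt_eqF// -expRD ler_expR.
have l1 : ln a - ln K <= ln t by rewrite -ln_div ?posrE// ler_ln ?posrE// divr_gt0.
have l2 : ln t <= ln K + ln a by rewrite -lnM ?posrE// ler_ln ?posrE// mulr_gt0.
have : `|b * (ln a - ln t)| <= `|b| * ln K.
  by rewrite normrM ler_wpM2l// ler_norml; apply/andP; split; lra.
by move=> /(le_trans (ler_norm _)); lra.
Qed.

(** The integrand of [weighted_energy]. *)
Definition energy_density (R : realType) (N : nat) (s a1 a2 : R) (Phi : R -> R)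
    (u : 'rV[R]_N -> R) (p : 'rV[R]_N * 'rV[R]_N) : R :=
  Phi (enorm p.1 `^ a1 * enorm p.2 `^ a2 * `|holder_quotient s u p.1 p.2|)
  / enorm (p.1 - p.2) ^+ N.

Section energy_density.
Context (R : realType) (N : nat) (s a1 a2 : R).
Hypothesis (N1 : (1 <= N)%N) (s0 : 0 < s).
Let gamma := s - a1 - a2.

(** For points of two neighbouring shells all of [|x|], [|y|] lie within a constant
factor of [a], and [|x - y|] is at most a constant times [a], so the weight is at
least a multiple of [a^(a1 + a2 - s) = a^-gamma].  The growth bound takes that
multiple out of [Psi]. *)
Lemma energy_density_ge (Phi Psi : R -> R) (C1 : R) :
  orlicz Psi -> 0 < C1 -> (forall t, 0 <= t -> C1 * Psi t <= Phi t) ->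
  exists2 c : R, 0 < c & forall (u : 'rV[R]_N -> R) (a b : R) x y,
    0 < a -> a <= 2 * b -> b <= 2 * a -> shell a x -> shell b y -> x != y ->
    c / a ^+ N * Psi (a `^ (- gamma) * `|u x - u y|) <=
    energy_density s a1 a2 Phi u (x, y).
Proof.
move=> oPsi C10 PhiPsi.
(* |x| <= 2 N a and |y| <= 2 N b <= 4 N a, hence |x - y| <= 6 N a *)
have [K KE] : exists K : R, K = 6 * N%:R by exists (6 * N%:R).
have N1R : 1 <= N%:R :> R by rewrite ler1n.
have K1 : 1 <= K by rewrite KE; lra.
have K0 : 0 < K by lra.
set k := K `^ (- `|a1|) * K `^ (- `|a2|) * K `^ (- `|s|).
have k0 : 0 < k by rewrite !mulr_gt0// powR_gt0.
have k1 : k <= 1.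
  have le1 (e : R) : K `^ (- `|e|) <= 1.
    by rewrite -[leRHS](powRr0 K) ler_powR// oppr_le0.
  by rewrite !mulr_ile1 ?mulr_ge0 ?powR_ge0.
exists (C1 * k `^ p_plus Psi / K ^+ N).
  by rewrite divr_gt0 ?exprn_gt0// mulr_gt0// powR_gt0.
move=> u a b x y a0 ab ba xa yb xy; have b0 : 0 < b by lra.
have [x1 x2] : a <= enorm x /\ enorm x <= N%:R * (2 * a).
  by case: xa => ? ?; split; [apply: enorm_not_cube|apply: enorm_cube] => //; lra.
have [y1 y2] : b <= enorm y /\ enorm y <= N%:R * (2 * b).
  by case: yb => ? ?; split; [apply: enorm_not_cube|apply: enorm_cube] => //; lra.
have z2 : enorm (x - y) <= N%:R * (2 * a + 2 * b).
  by apply: enorm_sub_cube; [lra|lra|case: xa|case: yb].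
have z0 : 0 < enorm (x - y) by apply: enorm_gt0; rewrite subr_eq0.
have aK : a / K <= a / 2 by rewrite ler_pM2l// lef_pV2 ?posrE// KE; lra.
have zK : enorm (x - y) <= K * a by apply: le_trans z2 _; rewrite KE; nra.
have X : K `^ (- `|a1|) * a `^ a1 <= enorm x `^ a1.
  by apply: powR_comparable => //; [lra|rewrite KE; nra].
have Y : K `^ (- `|a2|) * a `^ a2 <= enorm y `^ a2.
  by apply: powR_comparable => //; [lra|rewrite KE; nra].
have Z : K `^ (- `|s|) * a `^ (- s) <= (enorm (x - y) `^ s)^-1.
  rewrite (ger0_norm (ltW s0)) -powRM ?(ltW K0) ?(ltW a0)// powRN.
  rewrite lef_pV2 ?posrE ?powR_gt0 ?mulr_gt0//.
  apply: ge0_ler_powR => //; rewrite ?nnegrE; first exact: ltW.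
    exact: ltW.
  by rewrite ltW// mulr_gt0.
rewrite /energy_density /=.
set d := `|u x - u y|.
have W : k * (a `^ (- gamma) * d) <=
    enorm x `^ a1 * enorm y `^ a2 * `|holder_quotient s u x y|.
  rewrite /holder_quotient normrM -/d (ger0_norm (x := _^-1)) ?invr_ge0 ?powR_ge0//.
  have -> : a `^ (- gamma) = a `^ a1 * a `^ a2 * a `^ (- s).
    rewrite -!powRD ?(gt_eqF a0) ?implybT//; congr (_ `^ _); rewrite /gamma; ring.
  rewrite [d * _]mulrC !mulrA ler_wpM2r ?normr_ge0// /k.
  have -> : K `^ (- `|a1|) * K `^ (- `|a2|) * K `^ (- `|s|) *
      a `^ a1 * a `^ a2 * a `^ (- s) =
    (K `^ (- `|a1|) * a `^ a1) * (K `^ (- `|a2|) * a `^ a2) *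
      (K `^ (- `|s|) * a `^ (- s)) by ring.
  by do 2 (apply: ler_pM => //; rewrite ?mulr_ge0 ?powR_ge0//).
have d0 : 0 <= a `^ (- gamma) * d by rewrite mulr_ge0 ?powR_ge0 /d.
have G : k `^ p_plus Psi * Psi (a `^ (- gamma) * d) <= Psi (k * (a `^ (- gamma) * d)).
  have := orlicz_growth oPsi (l := k^-1) (t := k * (a `^ (- gamma) * d)).
  rewrite mulKf ?gt_eqF// invf_ge1// => /(_ k1 (mulr_ge0 (ltW k0) d0)).
  rewrite -(powR_inv1 (ltW k0)) -powRrM mulN1r (powRN k).
  by rewrite ler_pdivlMl ?powR_gt0.
apply: (@le_trans _ _ (C1 * Psi (k * (a `^ (- gamma) * d)) / (K * a) ^+ N)).
  have -> : C1 * k `^ p_plus Psi / K ^+ N / a ^+ N * Psi (a `^ (- gamma) * d) =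
      C1 * (k `^ p_plus Psi * Psi (a `^ (- gamma) * d)) / (K * a) ^+ N.
    by rewrite exprMn invfM; ring.
  apply: ler_wpM2r; first by rewrite invr_ge0 exprn_ge0// mulr_ge0 ?ltW.
  by apply: ler_wpM2l => //; exact: ltW.
have kd0 : 0 <= k * (a `^ (- gamma) * d) by rewrite mulr_ge0// ltW.
apply: ler_pM.
- by rewrite mulr_ge0 ?(ltW C10)// orlicz_ge0.
- by rewrite invr_ge0 exprn_ge0// mulr_ge0 ?ltW.
- apply: le_trans (PhiPsi _ (le_trans kd0 W)).
  by apply: ler_wpM2l; [exact: ltW|exact: orlicz_nondecreasing].
- rewrite lef_pV2 ?posrE ?exprn_gt0 ?mulr_gt0//.
  by rewrite lerXn2r// nnegrE ltW// mulr_gt0.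
Qed.

End energy_density.

(** * The critical Hardy inequality on a family of shells *)

Lemma measurable_fun_powR d (T : measurableType d) (R : realType) (f : T -> R) b :
  measurable_fun [set: T] f -> measurable_fun [set: T] (fun x => f x `^ b).
Proof.
move=> mf.
exact: (@measurableT_comp _ _ _ _ _ _ (fun t : R => t `^ b) _ f (measurable_powR b) mf).
Qed.

Section shell_hardy.
Context (R : realType) (N : nat) (s a1 a2 : R) (Phi Psi : R -> R).
Context (C1 C2 : R) (a_ : nat -> R).
Hypotheses (N1 : (1 <= N)%N) (s0 : 0 < s).
Let gamma := s - a1 - a2.
Hypotheses (g0 : 0 < gamma) (oPhi : orlicz Phi) (oPsi : orlicz Psi).
Hypotheses (C10 : 0 < C1) (C20 : 0 < C2).
Hypothesis PhiPsi : forall t, 0 <= t -> C1 * Psi t <= Phi t /\ Phi t <= C2 * Psi t.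
Hypothesis a0 : forall n, 0 < a_ n.
Hypotheses (aS : forall n, a_ n.+1 <= 2 * a_ n) (Sa : forall n, a_ n <= 2 * a_ n.+1).
Hypothesis a_disj : forall m n (x : 'rV[R]_N),
  shell (a_ m) x -> shell (a_ n) x -> m = n.
(* This is where gamma is critical: the factor is the ratio of the volumes of
   the two shells. *)
Hypothesis critical : forall n t, 0 <= t ->
  Psi (a_ n.+1 `^ (- gamma) * t) <=
  (a_ n / a_ n.+1) ^+ N * Psi (a_ n `^ (- gamma) * t).

Local Notation mu := (lebesgue_rV R N).
Let q := p_plus Psi.

Definition shell_mass (u : 'rV[R]_N -> R) n : \bar R :=
  (\int[mu]_(x in shell (a_ n)) (Psi (a_ n `^ (- gamma) * `|u x|))%:E)%E.

(** The factor [a_ n.+1 ^- N] is, up to a constant, one over the volume of either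
shell: this is an average in one variable and an integral in the other. *)
Definition shell_osc (u : 'rV[R]_N -> R) n : \bar R :=
  (((a_ n.+1 ^+ N)^-1)%:E *
   \int[mu \x mu]_(p in shell (a_ n.+1) `*` shell (a_ n))
     (Psi (a_ n.+1 `^ (- gamma) * `|u p.1 - u p.2|))%:E)%E.

Let V : R := 4 ^+ N - 2 ^+ N.

Let V0 : 0 < V.
Proof. by rewrite subr_gt0 ltrXn2r// ?nnegrE// -?lt0n// ltr_nat. Qed.

Section fixed_function.
Variable u : 'rV[R]_N -> R.
Hypothesis meas_u : measurable_fun [set: 'rV[R]_N] u.

Let arg0 (a t : R) : 0 <= a `^ (- gamma) * `|t|.
Proof. by rewrite mulr_ge0 ?powR_ge0. Qed.

Lemma measurable_shell_mass_density n :
  measurable_fun [set: 'rV[R]_N] (fun x => Psi (a_ n `^ (- gamma) * `|u x|)).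
Proof.
apply: measurable_orlicz_comp => //; apply: measurable_funM => //.
exact: measurableT_comp.
Qed.

Let mu1 : measurable_fun [set: 'rV[R]_N * 'rV[R]_N] (fun p => u p.1).
Proof. exact: (measurableT_comp meas_u). Qed.

Let mu2 : measurable_fun [set: 'rV[R]_N * 'rV[R]_N] (fun p => u p.2).
Proof. exact: (measurableT_comp meas_u). Qed.

Lemma measurable_shell_osc_density n : measurable_fun [set: 'rV[R]_N * 'rV[R]_N]
  (fun p => Psi (a_ n.+1 `^ (- gamma) * `|u p.1 - u p.2|)).
Proof.
apply: measurable_orlicz_comp => //; apply: measurable_funM => //.
by apply: measurableT_comp => //; exact: measurable_funB.
Qed.

Lemma measurable_energy_density : measurable_fun [set: 'rV[R]_N * 'rV[R]_N]
  (energy_density s a1 a2 Phi u).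
Proof.
have mz : measurable_fun [set: 'rV[R]_N * 'rV[R]_N] (fun p => enorm (p.1 - p.2)).
  apply: measurable_enorm_comp => i.
  rewrite (_ : (fun _ => _) =
    (fun p : 'rV[R]_N * 'rV[R]_N => p.1 ord0 i - p.2 ord0 i)); last first.
    by apply/funext => p; rewrite !mxE.
  apply: measurable_funB.
    exact: (measurableT_comp (@measurable_coord _ R N i)).
  exact: (measurableT_comp (@measurable_coord _ R N i)).
have mi d (T : measurableType d) (f : T -> R) :
    measurable_fun [set: T] f -> (forall x, 0 <= f x) ->
    measurable_fun [set: T] (fun x => (f x)^-1).
  move=> mf' f0; rewrite (_ : (fun _ => _) = (fun x => f x `^ (-1))).
    exact: measurable_fun_powR.
  by apply/funext => x /=; rewrite powR_inv1.
apply: measurable_funM; last first.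
  apply: mi => [|p]; first exact: measurable_funX.
  by rewrite exprn_ge0// enorm_ge0.
apply: measurable_orlicz_comp => //.
  by move=> p; rewrite !mulr_ge0 ?powR_ge0.
apply: measurable_funM; first apply: measurable_funM.
- by apply: measurable_fun_powR; exact: (measurableT_comp (@measurable_enorm R N)).
- by apply: measurable_fun_powR; exact: (measurableT_comp (@measurable_enorm R N)).
- apply: measurableT_comp => //; apply: measurable_funM; first exact: measurable_funB.
  by apply: mi => [|p]; [exact: measurable_fun_powR|exact: powR_ge0].
Qed.

Lemma energy_density_ge0 p : 0 <= energy_density s a1 a2 Phi u p.
Proof.
rewrite divr_ge0 ?exprn_ge0 ?enorm_ge0//.
by rewrite (orlicz_ge0 oPhi)// !mulr_ge0 ?powR_ge0.
Qed.

Lemma shell_mass_ge0 n : (0 <= shell_mass u n)%E.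
Proof. by apply: integral_ge0 => x _; rewrite lee_fin orlicz_ge0. Qed.

Lemma shell_osc_ge0 n : (0 <= shell_osc u n)%E.
Proof.
rewrite /shell_osc mule_ge0//; first by rewrite lee_fin invr_ge0 exprn_ge0// ltW.
by apply: integral_ge0 => x _; rewrite lee_fin orlicz_ge0.
Qed.

(** Integrate [orlicz_quasi_add] over the two shells.  Passing from the scale
[a_ n.+1] to [a_ n] in the term of [G_n] produces the factor
[(a_ n / a_ n.+1) ^ N] of [critical], and the volumes of the shells produce its
inverse. *)
Lemma shell_mass_step n th : 0 < th -> th < 1 ->
  (shell_mass u n.+1 <= (th `^ (1 - q))%:E * shell_mass u n +
    (2 ^+ N / V * (1 - th) `^ (1 - q))%:E * shell_osc u n)%E.
Proof.
move=> th0 th1.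
set A := a_ n.+1 ^+ N; set B := a_ n ^+ N.
have A0 : 0 < A by rewrite exprn_gt0.
have B0 : 0 < B by rewrite exprn_gt0.
have AB : A <= 2 ^+ N * B.
  by rewrite -exprMn lerXn2r ?nnegrE ?mulr_ge0 ?(ltW (a0 _)).
set c1 := th `^ (1 - q); set c2 := (1 - th) `^ (1 - q).
have c10 : 0 <= c1 by exact: powR_ge0.
have c20 : 0 <= c2 by exact: powR_ge0.
have := @integral_pairing _ _ _ _ R mu mu _ _ (@measurable_shell R N (a_ n.+1))
  (@measurable_shell R N (a_ n)) _ _ _ (c1 * (B / A)) c2
  (fun x => orlicz_ge0 oPsi (arg0 (a_ n.+1) (u x)))
  (fun x => orlicz_ge0 oPsi (arg0 (a_ n) (u x)))
  (fun p => orlicz_ge0 oPsi (arg0 (a_ n.+1) (u p.1 - u p.2)))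
  (measurable_shell_mass_density n.+1) (measurable_shell_mass_density n)
  (measurable_shell_osc_density n).
have BA : 0 <= B / A by rewrite divr_ge0 ?ltW.
move=> /(_ (mulr_ge0 c10 BA) c20).
rewrite !lebesgue_shell// -/V -/A -/B.
rewrite -/(shell_mass u n.+1) -/(shell_mass u n).
set I := (\int[_]_(z in _) _)%E => H.
have {H} H : ((V * B)%:E * shell_mass u n.+1 <=
    (c1 * (B / A))%:E * ((V * A)%:E * shell_mass u n) + c2%:E * I)%E.
  apply: H => x y _ _.
  set e := a_ n.+1 `^ (- gamma).
  have e0 : 0 <= e by exact: powR_ge0.
  have tri : `|u x| <= `|u y| + `|u x - u y|.
    by rewrite -[X in `|X| <= _](subrK (u y)) addrC ler_normD.
  have : Psi (e * `|u x|) <= Psi (e * `|u y| + e * `|u x - u y|).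
    apply: orlicz_nondecreasing => //; first exact: arg0.
    by rewrite -mulrDr ler_wpM2l.
  move=> /le_trans; apply.
  apply: (le_trans (orlicz_quasi_add oPsi th0 th1 (arg0 _ _) (arg0 _ _))).
  rewrite -/q -/c1 -/c2 lerD2r -mulrA ler_wpM2l// /B /A -expr_div_n.
  exact: critical.
have VB0 : 0 < V * B by rewrite mulr_gt0.
rewrite -(@lee_pmul2l _ (V * B)%:E)// ?lte_fin//.
apply: (le_trans H); rewrite [leRHS]ge0_muleDr; last 2 first.
- by rewrite mule_ge0// ?shell_mass_ge0// lee_fin.
- by rewrite mule_ge0// ?shell_osc_ge0// lee_fin mulr_ge0// divr_ge0 ?exprn_ge0// ltW.
apply: leeD.
  rewrite !muleA -!EFinM le_eqVlt; apply/orP; left; apply/eqP.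
  by congr (_%:E * _)%E; field; rewrite (gt_eqF A0).
have I0 : (0 <= I)%E by rewrite /I; apply: integral_ge0 => x _; rewrite lee_fin orlicz_ge0.
rewrite /shell_osc -/I !muleA -!EFinM lee_wpmul2r// lee_fin -/A.
rewrite (_ : _ * A^-1 = c2 * (2 ^+ N * B / A)); last by field; rewrite (gt_eqF A0) (gt_eqF V0).
by rewrite -[leLHS]mulr1 ler_wpM2l// ler_pdivlMr// mul1r.
Qed.

End fixed_function.

(** The products of consecutive shells are pairwise disjoint, and each of them
carries an energy of at least a multiple of [shell_osc u n]. *)
Lemma sum_shell_osc_le : exists2 C : R, 0 < C & forall u : 'rV[R]_N -> R,
  measurable_fun [set: 'rV[R]_N] u ->
  (\sum_(0 <= n <oo) shell_osc u n <= C%:E * weighted_energy s a1 a2 Phi u)%E.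
Proof.
have [c c0 Hc] := energy_density_ge a1 a2 N1 s0 oPsi C10 (fun t t0 => (PhiPsi t0).1).
exists c^-1 => [|u meas_u]; first by rewrite invr_gt0.
rewrite -(@lee_pmul2l _ c%:E)// muleA -EFinM divff ?gt_eqF// mul1e.
rewrite -nneseriesZl => [|n _]; last exact: shell_osc_ge0.
have me := measurable_energy_density meas_u.
pose S n : set ('rV[R]_N * 'rV[R]_N) := shell (a_ n.+1) `*` shell (a_ n).
have mS n : measurable (S n).
  by apply: measurableX; exact: measurable_shell.
have mUS : measurable (\bigcup_n S n) by exact: bigcupT_measurable.
have meE D : measurable_fun D (fun p => (energy_density s a1 a2 Phi u p)%:E).
  by apply/measurable_EFinP; exact: measurable_funTS.
apply: (@le_trans _ _
    (\int[mu \x mu]_(p in \bigcup_n S n) (energy_density s a1 a2 Phi u p)%:E)%E).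
  rewrite ge0_integral_bigcup//; last 2 first.
  - by move=> p _; rewrite lee_fin energy_density_ge0.
  - move=> m n _ _ [[x y] [[/= xm _] [/= xn _]]].
    by have [] := a_disj xm xn.
  apply: lee_nneseries => n _.
    by rewrite mule_ge0 ?shell_osc_ge0// lee_fin ltW.
  rewrite /shell_osc muleA -EFinM -/(S n).
  have mh := measurable_shell_osc_density meas_u n.
  rewrite -ge0_integralZl//; last 3 first.
  - by apply: measurable_funTS; exact/measurable_EFinP.
  - by move=> p _; rewrite lee_fin (orlicz_ge0 oPsi)// mulr_ge0 ?powR_ge0.
  - by rewrite lee_fin divr_ge0 ?exprn_ge0 ?ltW.
  apply: ge0_le_integral => //.
  - move=> p _; rewrite -EFinM lee_fin mulr_ge0//.
      by rewrite divr_ge0 ?exprn_ge0 ?ltW.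
    by rewrite (orlicz_ge0 oPsi)// mulr_ge0 ?powR_ge0.
  - by apply: measurable_funTS; apply: measurable_funeM; exact/measurable_EFinP.
  - move=> [x y] [/= xS yS]; rewrite -EFinM lee_fin.
    apply: (Hc u _ _ x y (a0 _) (aS n) (Sa n) xS yS); apply/eqP => xy; rewrite -xy in yS.
    by have /esym/n_Sn := a_disj xS yS.
by apply: ge0_subset_integral => // p _; rewrite lee_fin energy_density_ge0.
Qed.

(** Both halves of the theorem are instances, which differ in the progression [a_],
in the domain [D] and in the logarithm [L].  The origin belongs to no shell, but
the integrand vanishes there. *)
Lemma critical_shell_hardy (b : R) : 0 < b ->
  exists2 C : R, 0 < C &
    forall (u L : 'rV[R]_N -> R) (D : set 'rV[R]_N),
    measurable_fun [set: 'rV[R]_N] u -> measurable_fun [set: 'rV[R]_N] L ->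
    measurable D ->
    (forall x, shell (a_ 0%N) x -> u x = 0) ->
    (forall n x, D x -> shell (a_ n.+1) x -> b * n.+1%:R <= L x) ->
    (forall x, D x -> x = 0 \/ exists n, shell (a_ n.+1) x) ->
    (\int[mu]_(x in D) (Phi (enorm x `^ (- gamma) * `|u x|) / L x `^ q)%:E
      <= C%:E * weighted_energy s a1 a2 Phi u)%E.
Proof.
move=> b0; have q1 : 1 < q := p_plus_gt1 oPsi.
have [C3 C30 osc_le] := sum_shell_osc_le.
have K0 : 0 < 2 ^+ N / V by rewrite divr_gt0 ?exprn_gt0.
set C4 := 2 ^+ N / V * 2 `^ (q - 1) * (3 * q / (q - 1)).
have C40 : 0 < C4 by rewrite !mulr_gt0 ?powR_gt0 ?invr_gt0//; lra.
set C5 := C2 * b `^ (- q).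
have C50 : 0 < C5 by rewrite mulr_gt0// powR_gt0.
exists (C5 * (C4 * C3)) => [|u L D meas_u mL mD u0 bL Dcover].
  exact: (mulr_gt0 C50 (mulr_gt0 C40 C30)).
pose f x := Phi (enorm x `^ (- gamma) * `|u x|) / L x `^ q.
have argx0 x : 0 <= enorm x `^ (- gamma) * `|u x| by rewrite mulr_ge0 ?powR_ge0.
have f0 x : 0 <= f x by rewrite divr_ge0 ?powR_ge0// orlicz_ge0.
have mf : measurable_fun [set: 'rV[R]_N] (fun x => (f x)%:E).
  apply/measurable_EFinP; apply: measurable_funM.
    apply: measurable_orlicz_comp => //; apply: measurable_funM.
      by apply: measurable_fun_powR; exact: measurable_enorm.
    exact: measurableT_comp.
  rewrite (_ : (fun _ => _) = (fun x => L x `^ (- q))).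
    exact: measurable_fun_powR.
  by apply/funext => x; rewrite powRN.
have mfD A : measurable_fun A (fun x => (f x)%:E) by exact: measurable_funTS.
pose S n : set 'rV[R]_N := D `&` shell (a_ n.+1).
have mS n : measurable (S n) by apply: measurableI => //; exact: measurable_shell.
have -> : (\int[mu]_(x in D) (f x)%:E = \int[mu]_(x in \bigcup_n S n) (f x)%:E)%E.
  have -> : \bigcup_n S n = D `&` \bigcup_n S n.
    by apply/esym/setIidPr; apply: bigcup_sub => n _ x [].
  rewrite integral_mkcondr; apply: eq_integral => x /set_mem Dx.
  rewrite patchE; case: ifPn => // /negP xS.
  have [x0|[n xn]] := Dcover x Dx; last by exfalso; apply: xS; apply/mem_set; exists n.
  have enx : enorm x = 0.
    rewrite x0 /enorm big1 ?sqrtr0// => i _; by rewrite mxE expr0n.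
  (* 0 `^ (- gamma) = 0, as gamma is not 0 *)
  rewrite /f enx.
  by rewrite powR0 ?mul0r ?orlicz0 ?mul0r// oppr_eq0 gt_eqF.
rewrite ge0_integral_bigcup//; last 2 first.
- by move=> x _; rewrite lee_fin.
- by move=> m n _ _ [x [[_ xm] [_ xn]]]; have [] := a_disj xm xn.
have G0 := shell_mass_ge0 u; have D0 := shell_osc_ge0 u.
have mass0 : shell_mass u 0 = 0%E.
  by apply: integral0_eq => x xS; rewrite u0// normr0 mulr0 orlicz0.
have := discrete_hardy_ereal q1 K0 G0 D0 mass0 (shell_mass_step meas_u).
rewrite -/C4 => hardy.
have bound n : (\int[mu]_(x in S n) (f x)%:E <=
    C5%:E * ((n.+1%:R `^ (- q))%:E * shell_mass u n.+1))%E.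
  rewrite muleA -EFinM /shell_mass.
  have mg := measurable_shell_mass_density meas_u n.+1.
  have w0 : 0 <= C5 * n.+1%:R `^ (- q) by rewrite mulr_ge0 ?powR_ge0 ?ltW.
  rewrite -ge0_integralZl//; last 3 first.
  - exact: measurable_shell.
  - by apply: measurable_funTS; exact/measurable_EFinP.
  - by move=> x _; rewrite lee_fin (orlicz_ge0 oPsi)// mulr_ge0 ?powR_ge0.
  have term0 x : (0 <= (C5 * n.+1%:R `^ (- q))%:E *
      (Psi (a_ n.+1 `^ (- gamma) * `|u x|))%:E)%E.
    by rewrite mule_ge0// lee_fin// (orlicz_ge0 oPsi)// mulr_ge0 ?powR_ge0.
  have mg' : measurable_fun [set: 'rV[R]_N] (fun x => (C5 * n.+1%:R `^ (- q))%:E *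
      (Psi (a_ n.+1 `^ (- gamma) * `|u x|))%:E)%E.
    by apply: measurable_funeM; exact/measurable_EFinP.
  apply: (@le_trans _ _ (\int[mu]_(x in S n) ((C5 * n.+1%:R `^ (- q))%:E *
      (Psi (a_ n.+1 `^ (- gamma) * `|u x|))%:E))%E); last first.
    apply: ge0_subset_integral => //; first exact: measurable_shell.
      exact: measurable_funTS.
    by move=> x [].
  apply: ge0_le_integral => //.
  - by move=> x _; rewrite lee_fin.
  - exact: measurable_funTS.
  move=> x [Dx xS]; rewrite -EFinM lee_fin /f.
  have ax : a_ n.+1 <= enorm x by case: xS => _; apply: enorm_not_cube; exact: ltW.
  have x0 : 0 < enorm x by apply: lt_le_trans ax.
  have Lb := bL n x Dx xS.
  have bn0 : 0 < b * n.+1%:R by rewrite mulr_gt0.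
  have -> : C5 * n.+1%:R `^ (- q) * Psi (a_ n.+1 `^ (- gamma) * `|u x|) =
    (C2 * Psi (a_ n.+1 `^ (- gamma) * `|u x|)) * (b * n.+1%:R) `^ (- q).
    by rewrite powRM ?(ltW b0)// /C5; ring.
  rewrite -powRN; apply: ler_pM; rewrite ?powR_ge0// ?(orlicz_ge0 oPhi)//.
    apply: le_trans (PhiPsi (argx0 x)).2 _; rewrite ler_wpM2l ?(ltW C20)//.
    apply: orlicz_nondecreasing => //; rewrite ler_wpM2r//.
    rewrite !powRN lef_pV2 ?posrE ?powR_gt0//.
    by apply: ge0_ler_powR; rewrite ?nnegrE ?(ltW g0) ?(ltW x0)// ltW.
  rewrite !powRN lef_pV2 ?posrE ?powR_gt0//; last exact: lt_le_trans Lb.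
  apply: ge0_ler_powR; rewrite ?nnegrE ?(ltW bn0)//; first lra.
  by apply: le_trans Lb; exact: ltW.
apply: (@le_trans _ _ (\sum_(0 <= n <oo)
    (C5%:E * ((n.+1%:R `^ (- q))%:E * shell_mass u n.+1)))%E).
  apply: lee_nneseries => n _; last exact: bound.
  by move=> _; apply: integral_ge0 => x _; rewrite lee_fin.
rewrite nneseriesZl; last by move=> n _; rewrite mule_ge0// lee_fin powR_ge0.
rewrite (EFinM C5) -muleA lee_wpmul2l ?lee_fin ?(ltW C50)//.
apply: (le_trans hardy); rewrite (EFinM C4) -muleA.
by rewrite lee_wpmul2l ?lee_fin ?(ltW C40)// osc_le.
Qed.

End shell_hardy.

(** * Supports inside and outside a ball *)

(** From [ln y >= n ln 2 - ln M] alone the bound could fail for small [n]; there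
[ln y >= ln 2] helps. *)
Lemma ln_ge_linear (R : realType) (M : R) : 1 <= M ->
  exists2 b : R, 0 < b &
    forall n y, 2 <= y -> 2 ^+ n <= M * y -> b * n%:R <= ln y.
Proof.
move=> M1; have l2 : 0 < ln 2 :> R by rewrite ln_gt0; lra.
have lM : 0 <= ln M by exact: ln_ge0.
exists (ln 2 / (1 + ln M / ln 2)) => [|n y y2 yn].
  by rewrite divr_gt0// ltr_pwDl// divr_ge0// ltW.
have y0 : 0 < y by lra.
have M0 : 0 < M by lra.
have d0 : 0 < 1 + ln M / ln 2 by rewrite ltr_pwDl// divr_ge0// ltW.
rewrite mulrAC ler_pdivrMr//.
have : ln (2 ^+ n) <= ln (M * y) :> R by rewrite ler_ln ?posrE ?mulr_gt0 ?exprn_gt0.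
rewrite lnXn// lnM ?posrE// -[ln 2 *+ n]mulr_natr => /le_trans; apply.
rewrite mulrDr mulr1 addrC lerD2l mulrA mulrAC ler_peMl// ler_pdivlMr// mul1r.
by rewrite ler_ln ?posrE.
Qed.

Lemma shell_scale_disjoint (R : realType) (N : nat) (a_ : nat -> R) :
  (forall m n, (m < n)%N -> 2 * a_ m <= a_ n) ->
  forall m n (x : 'rV[R]_N), shell (a_ m) x -> shell (a_ n) x -> m = n.
Proof.
move=> aa m n x xm xn; case: (ltngtP m n) => // mn.
- by have := shell_disjoint (aa _ _ mn) xm xn.
- by have := shell_disjoint (aa _ _ mn) xn xm.
Qed.

Lemma shell_scale_disjoint_decr (R : realType) (N : nat) (a_ : nat -> R) :
  (forall m n, (m < n)%N -> 2 * a_ n <= a_ m) ->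
  forall m n (x : 'rV[R]_N), shell (a_ m) x -> shell (a_ n) x -> m = n.
Proof.
move=> aa m n x xm xn; case: (ltngtP m n) => // mn.
- by have := shell_disjoint (aa _ _ mn) xn xm.
- by have := shell_disjoint (aa _ _ mn) xm xn.
Qed.

Lemma C1c_measurable (R : realType) (N : nat) (u : 'rV[R]_N -> R) :
  C1c u -> measurable_fun [set: 'rV[R]_N] u.
Proof.
by case=> du _ _; apply: continuous_measurable_rV => x; exact: differentiable_continuous.
Qed.

Lemma supp_subset0 (R : realType) (N : nat) (u : 'rV[R]_N -> R) (A : set 'rV[R]_N) x :
  supp u `<=` A -> ~ A x -> u x = 0.
Proof.
move=> uA Ax; apply: contrapT => ux; apply: Ax; apply: uA.
by apply: subset_closure; exact/eqP.
Qed.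

Lemma cube_enorm (R : realType) (N : nat) (a : R) (x : 'rV[R]_N) :
  0 <= a -> enorm x < a -> cube a x.
Proof.
move=> a0 xa; apply: contrapT => /(enorm_not_cube a0).
by rewrite leNgt xa.
Qed.

Lemma measurable_eball (R : realType) (N : nat) (r : R) :
  measurable (@eball R N r).
Proof.
rewrite (_ : eball _ = [set: 'rV[R]_N] `&` @enorm R N @^-1` `]-oo, r[%classic).
  exact: measurable_enorm.
by rewrite setTI; apply/seteqP; split => x; rewrite /eball /= in_itv.
Qed.

Section interior_and_exterior.
Context (R : realType) (N : nat) (s a1 a2 r : R) (Phi Psi : R -> R) (C1 C2 : R).
Hypotheses (N1 : (1 <= N)%N) (s0 : 0 < s) (r0 : 0 < r).
Hypotheses (oPhi : orlicz Phi) (oPsi : orlicz Psi) (C10 : 0 < C1) (C20 : 0 < C2).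
Hypothesis PhiPsi : forall t, 0 <= t -> C1 * Psi t <= Phi t /\ Phi t <= C2 * Psi t.
Let gamma := s - a1 - a2.

Let N0 : 0 < N%:R :> R.
Proof. by rewrite ltr0n. Qed.

(** Shells shrinking to the origin from the first one outside the ball; going one
step inwards scales the argument of [Psi] by [2^gamma >= 1], so that the upper
index decides. *)
Lemma critical_hardy_in : gamma = N%:R / p_plus Psi ->
  exists2 C : R, 0 < C &
    forall u : 'rV[R]_N -> R, C1c u -> supp u `<=` @eball R N r ->
      (\int[lebesgue_rV R N]_(x in @eball R N r)
         (Phi (enorm x `^ (- gamma) * `|u x|)
          / ln (2 * r / enorm x) `^ p_plus Psi)%:E
       <= C%:E * weighted_energy s a1 a2 Phi u)%E.
Proof.
move=> gE; have q1 := p_plus_gt1 oPsi.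
have q0 : 0 < p_plus Psi by lra.
have g0 : 0 < gamma by rewrite gE divr_gt0.
pose a_ n : R := r / 2 ^+ n.
have a0 n : 0 < a_ n by rewrite divr_gt0// exprn_gt0.
have aS n : a_ n = 2 * a_ n.+1.
  by rewrite /a_ exprS; field; rewrite expf_neq0.
have adisj : forall m n (x : 'rV[R]_N), shell (a_ m) x -> shell (a_ n) x -> m = n.
  apply: shell_scale_disjoint_decr => m n mn.
  have -> : 2 * a_ n = r / 2 ^+ n.-1.
    by rewrite /a_ -{1}(ltn_predK mn) exprS; field; rewrite expf_neq0.
  rewrite ler_pM2l// lef_pV2 ?posrE ?exprn_gt0// ler_eXn2l ?ltr1n//.
  by rewrite -ltnS (ltn_predK mn).
have crit n t : 0 <= t -> Psi (a_ n.+1 `^ (- gamma) * t) <=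
    (a_ n / a_ n.+1) ^+ N * Psi (a_ n `^ (- gamma) * t).
  move=> t0; rewrite [in a_ n / _](aS n) mulfK ?gt_eqF//.
  have -> : a_ n.+1 `^ (- gamma) * t = 2 `^ gamma * (a_ n `^ (- gamma) * t).
    rewrite (aS n) powRM ?(ltW (a0 _))// (powRN 2) !mulrA divff ?mul1r//.
  have -> : 2 ^+ N = (2 `^ gamma) `^ p_plus Psi :> R.
    by rewrite -powRrM gE divfK ?gt_eqF// powR_mulrn.
  apply: orlicz_growth => //; last by rewrite mulr_ge0 ?powR_ge0.
  by rewrite -[leLHS](powRr0 2) ler_powR ?ler1n// ltW.
have [b b0 lnb] := @ln_ge_linear R N%:R ltac:(by rewrite ler1n).
have [C C0 HC] := @critical_shell_hardy R N s a1 a2 Phi Psi C1 C2 a_ N1 s0 g0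
  oPhi oPsi C10 C20 PhiPsi a0 ltac:(by move=> n; rewrite (aS n); have := a0 n.+1; lra)
  ltac:(by move=> n; rewrite -aS) adisj crit b b0.
exists C => // u uC1 usupp.
apply: (HC u (fun x => ln (2 * r / enorm x))) => //.
- exact: C1c_measurable.
- apply: (measurableT_comp (@measurable_ln R)); apply: measurable_funM => //.
  rewrite (_ : (fun _ => _) = (fun x : 'rV[R]_N => enorm x `^ (-1))).
    by apply: measurable_fun_powR; exact: measurable_enorm.
  by apply/funext => x; rewrite powR_inv1// enorm_ge0.
- exact: measurable_eball.
- move=> x [_ xS]; apply: (supp_subset0 usupp) => /=; apply/negP; rewrite -leNgt.
  by apply: enorm_not_cube; [exact: ltW|move: xS; rewrite /a_ expr0 divr1].
- move=> n x xr [x2 x1]; rewrite /eball /= in xr.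
  have ex0 : 0 < enorm x by apply: lt_le_trans (enorm_not_cube _ x1) => //; exact: ltW.
  apply: lnb; first by rewrite ler_pdivlMr// ler_pM2l// ltW.
  rewrite -aS in x2; have := enorm_cube (ltW (a0 n)) x2.
  rewrite /a_ mulrA ler_pdivlMr ?exprn_gt0// => H.
  by rewrite mulrA ler_pdivlMr// exprS; lra.
move=> x xr; have [->|x0] := eqVneq x 0; [by left|right].
have ex0 := enorm_gt0 x0.
have exk : exists k, `[< ~ cube (a_ k) x >].
  exists (Num.bound (N%:R * r / enorm x)); apply/asboolP => /(enorm_cube (ltW (a0 _))).
  apply/negP; rewrite -ltNge /a_ mulrA ltr_pdivrMr ?exprn_gt0// [ltRHS]mulrC -ltr_pdivrMr//.
  exact: upper_nthrootP.
case: (ex_minnP exk) => -[|k] /asboolP xk kmin.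
  by exfalso; apply: xk; apply: cube_enorm; rewrite /a_ expr0 divr1// ltW.
exists k; split => //; rewrite -aS; apply: contrapT => xk'.
by have := kmin k (asboolT xk'); rewrite ltnn.
Qed.

(** Shells growing from one inside the ball; going one step outwards scales the
argument of [Psi] by [2^-gamma <= 1], so that the lower index decides the value
of [gamma], while the exponent of the logarithm is still that of
[orlicz_quasi_add]. *)
Lemma critical_hardy_out : gamma = N%:R / p_minus Psi ->
  exists2 C : R, 0 < C &
    forall u : 'rV[R]_N -> R, C1c u -> supp u `<=` ~` @eball R N r ->
      (\int[lebesgue_rV R N]_(x in ~` @eball R N r)
         (Phi (enorm x `^ (- gamma) * `|u x|)
          / ln (2 * enorm x / r) `^ p_plus Psi)%:E
       <= C%:E * weighted_energy s a1 a2 Phi u)%E.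
Proof.
move=> gE; have p1 := p_minus_ge1 oPsi.
have p0 : 0 < p_minus Psi by lra.
have g0 : 0 < gamma by rewrite gE divr_gt0.
(* a factor 2 of room makes shell (a_ 0) lie in the open ball *)
pose c := r / (4 * N%:R); have c0 : 0 < c by rewrite divr_gt0// mulr_gt0.
pose a_ n : R := c * 2 ^+ n.
have a0 n : 0 < a_ n by rewrite mulr_gt0// exprn_gt0.
have aS n : a_ n.+1 = 2 * a_ n by rewrite /a_ exprS; ring.
have adisj : forall m n (x : 'rV[R]_N), shell (a_ m) x -> shell (a_ n) x -> m = n.
  apply: shell_scale_disjoint => m n mn.
  by rewrite -aS ler_pM2l// ler_eXn2l ?ltr1n.
have crit n t : 0 <= t -> Psi (a_ n.+1 `^ (- gamma) * t) <=
    (a_ n / a_ n.+1) ^+ N * Psi (a_ n `^ (- gamma) * t).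
  move=> t0; have an0 := a0 n.
  have -> : a_ n / a_ n.+1 = 2^-1 by rewrite aS invfM mulrCA divff ?mulr1// gt_eqF.
  have -> : a_ n.+1 `^ (- gamma) * t = 2 `^ (- gamma) * (a_ n `^ (- gamma) * t).
    by rewrite aS powRM ?(ltW (a0 _))// mulrA.
  have -> : 2^-1 ^+ N = (2 `^ (- gamma)) `^ p_minus Psi :> R.
    by rewrite -powRrM mulNr gE divfK ?gt_eqF// powRN powR_mulrn// exprVn.
  apply: orlicz_growth_le1 => //.
  - by rewrite -[leRHS](powRr0 2) ler_powR ?ler1n// oppr_le0 ltW.
  - by rewrite mulr_ge0 ?powR_ge0.
have [b b0 lnb] := @ln_ge_linear R (2 * N%:R)
  ltac:(by rewrite -natrM ler1n muln_gt0).
have [C C0 HC] := @critical_shell_hardy R N s a1 a2 Phi Psi C1 C2 a_ N1 s0 g0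
  oPhi oPsi C10 C20 PhiPsi a0 ltac:(by move=> n; rewrite aS)
  ltac:(by move=> n; rewrite aS mulrA ler_peMl ?(ltW (a0 n))//; lra) adisj crit b b0.
have small (x : 'rV[R]_N) : cube (2 * a_ 0%N) x -> enorm x < r.
  move=> /enorm_cube; rewrite mulr_ge0// ?(ltW (a0 _))// => /(_ isT)/le_lt_trans; apply.
  have -> : N%:R * (2 * a_ 0%N) = r / 2.
    by rewrite /a_ expr0 mulr1 /c; field; rewrite gt_eqF.
  by rewrite ltr_pdivrMr// ltr_pMr// ltr1n.
exists C => // u uC1 usupp.
apply: (HC u (fun x => ln (2 * enorm x / r))) => //.
- exact: C1c_measurable.
- apply: (measurableT_comp (@measurable_ln R)); apply: measurable_funM => //.
  by apply: measurable_funM => //; exact: measurable_enorm.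
- by apply: measurableC; exact: measurable_eball.
- by move=> x [xS _]; apply: (supp_subset0 usupp) => /=; apply; exact: small.
- move=> n x xr [x2 x1]; move: xr => /negP; rewrite -leNgt => xr.
  apply: lnb; first by rewrite ler_pdivlMr// ler_pM2l.
  have := enorm_not_cube (ltW (a0 _)) x1.
  rewrite /a_ /c mulrAC ler_pdivrMr ?mulr_gt0// => H.
  by rewrite mulrA ler_pdivlMr// mulrC; lra.
move=> x /negP; rewrite -leNgt => xr; right.
have exk : exists k, `[< cube (2 * a_ k) x >].
  exists (Num.bound (enorm x / (2 * c))); apply/asboolP; apply: cube_enorm.
    by rewrite mulr_ge0// ltW.
  rewrite /a_ mulrA mulrC -ltr_pdivrMr; last by rewrite mulr_gt0.
  exact: upper_nthrootP.
case: (ex_minnP exk) => -[|k] /asboolP xk kmin.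
  by have := small x xk; rewrite ltNge xr.
exists k; split => //; rewrite aS => xk'.
by have := kmin k (asboolT xk'); rewrite ltnn.
Qed.

End interior_and_exterior.

Theorem theorem1p4 (R : realType) (N : nat) (s a1 a2 r : R) (Phi : R -> R) :
  (1 <= N)%N -> 0 < s -> s < 1 -> 0 < r -> orlicz Phi ->
  let gamma := s - a1 - a2 in
  (p_oplus_attained Phi -> gamma = N%:R / p_oplus Phi ->
    exists2 C : R, 0 < C &
      forall u : 'rV[R]_N -> R, C1c u -> supp u `<=` @eball R N r ->
        (\int[lebesgue_rV R N]_(x in @eball R N r)
           (Phi (enorm x `^ (- gamma) * `|u x|)
            / ln (2 * r / enorm x) `^ p_oplus Phi)%:E
         <= C%:E * weighted_energy s a1 a2 Phi u)%E)
  /\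
  (forall Psi : R -> R, p_ominus_attained_at Phi Psi ->
    gamma = N%:R / p_ominus Phi ->
    exists2 C : R, 0 < C &
      forall u : 'rV[R]_N -> R, C1c u -> supp u `<=` ~` @eball R N r ->
        (\int[lebesgue_rV R N]_(x in ~` @eball R N r)
           (Phi (enorm x `^ (- gamma) * `|u x|)
            / ln (2 * enorm x / r) `^ p_plus Psi)%:E
         <= C%:E * weighted_energy s a1 a2 Phi u)%E).
Proof.
move=> N1 s0 _ r0 oPhi gamma; split.
  move=> [Psi [oPsi [C1 [C2 [C10 C20 PhiPsi]]] ->]].
  exact: (critical_hardy_in N1 s0 r0 oPhi oPsi C10 C20 PhiPsi).
move=> Psi [oPsi [C1 [C2 [C10 C20 PhiPsi]]] ->].
exact: (critical_hardy_out N1 s0 r0 oPhi oPsi C10 C20 PhiPsi).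
Qed.
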